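(* Let $\mathbb{F}\in\{\mathbb{R},\mathbb{C}\}$ and $n=p+q\ge 2$. Let $h^a:\mathbb{R}\to\mathcal{C}\ell^{\mathbb{F}}(p,q)$, $a=1,\dots,n$, be smooth functions satisfying $$h^a(x)h^b(x)+h^b(x)h^a(x)=2\eta^{ab}e,\qquad a,b=1,\dots,n,\quad \forall x\in\mathbb{R},$$ and, in the case of odd $n$, additionally $\mathrm{Tr}(h^{1\ldots n})=0$, where $h^{1\ldots n}:=h^1(x)\cdots h^n(x)$. Then there exists a function $T=T(x):\mathbb{R}\to\mathcal{C}\ell^{\mathbb{F}}(p,q)$ with invertible values such that $$e^a=T^{-1}(x)h^a(x)T(x),\qquad a=1,\dots,n,\quad\forall x\in\mathbb{R},$$ in the case of even $n$, and $$e^a=h^{1\ldots n}e_{1\ldots n}\,T^{-1}(x)h^a(x)T(x),\qquad a=1,\dots,n,\quad\forall x\in\mathbb{R},$$ in the case of odd $n$, where $h^{1\ldots n}e_{1\ldots n}=\pm e$. Moreover, $T(x)=S(x)K$, where $S(x)$ is any solution, invertible at every $x\in\mathbb{R}$, of the equation $$\frac{dS(x)}{dx}=C_1(x)S(x),$$ $C_1:\mathbb{R}\to\mathcal{N}$ is the unique $\mathcal{N}$-valued solution of the system $$\frac{dh^a}{dx}-[C_1,h^a]=0,\qquad a=1,\dots,n,$$ (with $\mathcal{N}$ the complement of the center of $\mathcal{C}\ell^{\mathbb{F}}(p,q)$ defined in the context), and $K$ is some invertible element of $\mathcal{C}\ell^{\mathbb{F}}(p,q)$ not depending on $x$.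
   Context: $\mathcal{C}\ell^{\mathbb{R}}(p,q)$, $n=p+q$, is the real Clifford algebra with identity $e$ and generators $e^1,\dots,e^n$ (independent of $x$) satisfying $e^ae^b+e^be^a=2\eta^{ab}e$, where $\eta=\|\eta^{ab}\|$ is the diagonal matrix with $p$ entries $1$ followed by $q$ entries $-1$. It has dimension $2^n$, with basis $e^{a_1\ldots a_k}:=e^{a_1}\cdots e^{a_k}$, $a_1<\dots<a_k$, $0\le k\le n$ (the empty product being $e$). $\mathcal{C}\ell^{\mathbb{C}}(p,q)=\mathbb{C}\otimes\mathcal{C}\ell^{\mathbb{R}}(p,q)$. $\mathcal{C}\ell^{\mathbb{F}}_k(p,q)$ is the $\mathbb{F}$-span of the basis elements with multi-index of length $k$. $\mathrm{Tr}:\mathcal{C}\ell^{\mathbb{F}}(p,q)\to\mathcal{C}\ell^{\mathbb{F}}_0(p,q)$ is the projection onto the grade-$0$ subspace along the other grades. $e_{1\ldots n}:=(e^{1\ldots n})^{-1}$ with $e^{1\ldots n}=e^1\cdots e^n$. $[U,W]=UW-WU$. The center of $\mathcal{C}\ell^{\mathbb{F}}(p,q)$ is $\mathcal{C}\ell^{\mathbb{F}}_0(p,q)$ for even $n$ and $\mathcal{C}\ell^{\mathbb{F}}_0(p,q)\oplus\mathcal{C}\ell^{\mathbb{F}}_n(p,q)$ for odd $n$; $\mathcal{N}:=\bigoplus_{k=1}^{2\lfloor n/2\rfloor}\mathcal{C}\ell^{\mathbb{F}}_k(p,q)$ is its complement consisting of elements with no central component. It is known (from earlier work) that under the stated hypotheses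 the system for $C_1$ has a unique $\mathcal{N}$-valued solution, given by $C_1=\sum_{k=1}^{2\lfloor n/2\rfloor}\mu_k\,\pi[h]_k\big(\sum_{a=1}^n\frac{dh^a}{dx}h_a\big)$, where $\mu_k=\frac{1}{n-(-1)^k(n-2k)}$, $h_a=(h^a)^{-1}$, and $\pi[h]_k$ is the projection onto the span of the products $h^{a_1}\cdots h^{a_k}$, $a_1<\dots<a_k$, with respect to the basis of all such ordered products. Functions into the algebra are smooth if their coordinates in the fixed basis are smooth. *)

(* Defs.v *)
From HB Require Import structures.
From mathcomp Require Import all_boot all_order all_algebra all_field.
From mathcomp Require Import ring.

Set Implicit Arguments.
Unset Strict Implicit.
Unset Printing Implicit Defensive.

Import Order.TTheory GRing.Theory Num.Theory.

Local Open Scope ring_scope.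

(* An element of the Clifford algebra is the family of its coordinates in the
   basis e^{a_1...a_k} = e^{a_1} ... e^{a_k}, a_1 < ... < a_k, which is indexed
   by the set {a_1, ..., a_k}. The index a : 'I_(p + q) runs from 0 to n - 1,
   not from 1 to n. With F the complex field this is the complexification of
   the real algebra of the same signature: the structure constants are 0, 1
   and -1. *)
Definition clifford (F : fieldType) (p q : nat) : Type :=
  {ffun {set 'I_(p + q)} -> F^o}.

Section Clifford.
Variables (F : fieldType) (p q : nat).
Local Notation n := (p + q)%N.
Local Notation Cl := (clifford F p q).
Implicit Types (A B C : {set 'I_n}) (U V W : Cl).

HB.instance Definition _ :=
  Vector.copy Cl {ffun {set 'I_n} -> F^o}.

Definition cl_eta (a b : 'I_n) : F :=
  if a == b then (if (a < p)%N then 1 else -1) else 0.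

(* The factor produced when the generator e^b, coming from the right, meets
   e^a: they are swapped if b < a, contracted if b = a, and left if a < b. *)
Definition swap_sign (a b : 'I_n) : F :=
  if (b < a)%N then -1 else if a == b then cl_eta a a else 1.

(* e^A e^B = blade_sign A B e^{symdiff A B} *)
Definition blade_sign A B : F := \prod_(a in A) \prod_(b in B) swap_sign a b.

Definition symdiff A B := (A :\: B) :|: (B :\: A).

Definition blade A : Cl := [ffun C => (C == A)%:R].

Definition cliff_mul U V : Cl :=
  [ffun C => \sum_A blade_sign A (symdiff A C) * (U A * V (symdiff A C))].

Lemma in_symdiff A B a : (a \in symdiff A B) = (a \in A) (+) (a \in B).
Proof. by rewrite !inE; case: (a \in A); case: (a \in B). Qed.

Lemma symdiffC A B : symdiff A B = symdiff B A.
Proof. by apply/setP => a; rewrite !in_symdiff addbC. Qed.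

Lemma symdiffA A B C : symdiff A (symdiff B C) = symdiff (symdiff A B) C.
Proof. by apply/setP => a; rewrite !in_symdiff addbA. Qed.

Lemma symdiffK A : involutive (symdiff A).
Proof. by move=> B; apply/setP => a; rewrite !in_symdiff addbA addbb. Qed.

Lemma symdiff0 A : symdiff set0 A = A.
Proof. by apply/setP => a; rewrite in_symdiff inE. Qed.

Lemma swap_sign_sq a b : swap_sign a b * swap_sign a b = 1.
Proof.
rewrite /swap_sign /cl_eta eqxx.
by case: ifP => _; [|case: ifP => _; [case: ifP => _|]]; rewrite ?mulrNN mulr1.
Qed.

Lemma prod_symdiff (f : 'I_n -> F) A B : (forall a, f a * f a = 1) ->
  \prod_(a in symdiff A B) f a = \prod_(a in A) f a * \prod_(a in B) f a.
Proof.
move=> f1; rewrite big_mkcond [X in _ = X * _]big_mkcond.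
rewrite [X in _ = _ * X]big_mkcond -big_split /=; apply: eq_bigr => a _.
rewrite in_symdiff.
by case: (a \in A); case: (a \in B); rewrite /= ?f1 ?mulr1 ?mul1r.
Qed.

Lemma blade_signDl A B C :
  blade_sign (symdiff A B) C = blade_sign A C * blade_sign B C.
Proof.
rewrite /blade_sign prod_symdiff // => a.
by rewrite -big_split big1 // => b _; rewrite /= swap_sign_sq.
Qed.

Lemma blade_signDr A B C :
  blade_sign A (symdiff B C) = blade_sign A B * blade_sign A C.
Proof.
rewrite /blade_sign -big_split; apply: eq_bigr => a _ /=.
by rewrite prod_symdiff // => b; rewrite swap_sign_sq.
Qed.

Lemma cliff_mulA : associative cliff_mul.
Proof.
move=> U V W; apply/ffunP => C; rewrite !ffunE.
under eq_bigr => A _ do rewrite ffunE mulr_sumr mulr_sumr.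
under [RHS]eq_bigr => D _ do rewrite ffunE mulr_suml mulr_sumr.
rewrite [RHS]exchange_big /=; apply: eq_bigr => A _.
rewrite [RHS](reindex_inj (inv_inj (symdiffK A))) /=; apply: eq_bigr => B _.
rewrite symdiffK; set D := symdiff B (symdiff A C).
have -> : symdiff (symdiff A B) C = D.
  by rewrite /D symdiffA (symdiffC B).
have -> : symdiff A C = symdiff B D by rewrite /D symdiffK.
rewrite blade_signDr blade_signDl; ring.
Qed.

Lemma cliff_mul_blade A B :
  cliff_mul (blade A) (blade B) = blade_sign A B *: blade (symdiff A B).
Proof.
apply/ffunP => C; rewrite !ffunE (bigD1 A) //= big1 ?addr0 => [|D /negPf DA].
  rewrite !ffunE eqxx mul1r.
  have -> : (symdiff A C == B) = (C == symdiff A B).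
    by apply/eqP/eqP => [<-|->]; rewrite symdiffK.
  by case: eqP => [->|_]; rewrite ?symdiffK // !(mulr0, scaler0).
by rewrite !ffunE DA mul0r mulr0.
Qed.

Lemma cliff_mulDl : left_distributive cliff_mul +%R.
Proof.
move=> U V W; apply/ffunP => C; rewrite !ffunE -big_split.
by apply: eq_bigr => A _; rewrite !ffunE mulrDl mulrDr.
Qed.

Lemma cliff_mulDr : right_distributive cliff_mul +%R.
Proof.
move=> U V W; apply/ffunP => C; rewrite !ffunE -big_split.
by apply: eq_bigr => A _; rewrite !ffunE mulrDr mulrDr.
Qed.

Lemma cliff_mulZl (c : F) U V : cliff_mul (c *: U) V = c *: cliff_mul U V.
Proof.
apply/ffunP => C; rewrite !ffunE scaler_sumr.
by apply: eq_bigr => A _; rewrite !ffunE /GRing.scale /=; ring.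
Qed.

Lemma cliff_mulZr (c : F) U V : cliff_mul U (c *: V) = c *: cliff_mul U V.
Proof.
apply/ffunP => C; rewrite !ffunE scaler_sumr.
by apply: eq_bigr => A _; rewrite !ffunE /GRing.scale /=; ring.
Qed.

Lemma blade_sign0l A : blade_sign set0 A = 1.
Proof. by rewrite /blade_sign big_set0. Qed.

Lemma blade_sign0r A : blade_sign A set0 = 1.
Proof. by rewrite /blade_sign big1 // => a _; rewrite big_set0. Qed.

Lemma cliff_mul1l : left_id (blade set0) cliff_mul.
Proof.
move=> U; apply/ffunP => C; rewrite !ffunE (bigD1 set0) //= big1.
  by rewrite ffunE eqxx symdiff0 blade_sign0l !mul1r addr0.
by move=> A /negPf A0; rewrite ffunE A0 mul0r mulr0.
Qed.

Lemma cliff_mul1r : right_id (blade set0) cliff_mul.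
Proof.
move=> U; apply/ffunP => C; rewrite !ffunE (bigD1 C) //= big1.
  have -> : symdiff C C = set0 by apply/setP => a; rewrite in_symdiff addbb inE.
  by rewrite ffunE eqxx blade_sign0r mul1r mulr1 addr0.
move=> A /negPf AC; rewrite ffunE.
have -> : (symdiff A C == set0) = false.
  apply/eqP => /setP AC0; move/eqP: AC; apply; apply/setP => a.
  by move: (AC0 a); rewrite in_symdiff inE => /negbT; rewrite -negb_eqb negbK => /eqP.
by rewrite !mulr0.
Qed.

Lemma cliff_oner_neq0 : blade set0 != 0 :> Cl.
Proof.
apply/eqP => /ffunP/(_ set0); rewrite !ffunE eqxx => /eqP.
by rewrite oner_eq0.
Qed.

HB.instance Definition _ := GRing.Zmodule_isNzRing.Build Cl
  cliff_mulA cliff_mul1l cliff_mul1r cliff_mulDl cliff_mulDr cliff_oner_neq0.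

Lemma cliff_scalerAl (c : F) U V : c *: (U * V) = (c *: U) * V.
Proof. by rewrite [RHS]cliff_mulZl. Qed.

Lemma cliff_scalerAr (c : F) U V : c *: (U * V) = U * (c *: V).
Proof. by rewrite [RHS]cliff_mulZr. Qed.

HB.instance Definition _ := GRing.Lmodule_isLalgebra.Build F Cl cliff_scalerAl.
HB.instance Definition _ := GRing.Lalgebra_isAlgebra.Build F Cl cliff_scalerAr.

HB.instance Definition _ := Algebra_isFalgebra.Build F Cl.

Definition gen (a : 'I_n) : Cl := blade [set a].

Lemma bladeM A B : blade A * blade B = blade_sign A B *: blade (symdiff A B).
Proof. exact: cliff_mul_blade. Qed.

Lemma gen_anticomm a b :
  gen a * gen b + gen b * gen a = (2 * cl_eta a b) *: 1.
Proof.
rewrite /gen !bladeM /blade_sign !big_set1 (symdiffC [set b]) -scalerDl.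
rewrite /swap_sign (eq_sym b a); case: (eqVneq a b) => [<-|ab].
  rewrite ltnn; congr (_ *: _); first by rewrite mulr_natl mulr2n.
  by congr blade; apply/setP => c; rewrite in_symdiff addbb inE.
rewrite /cl_eta (negPf ab) mulr0 scale0r.
by case: ltngtP ab => [_|_|/val_inj ->]; rewrite ?eqxx // ?subrr ?addNr scale0r.
Qed.

Lemma blade_prod_sorted (s : seq 'I_n) : sorted ltn (map val s) ->
  \prod_(a <- s) gen a = blade [set a in s].
Proof.
elim: s => [|a s IHs] /=.
  by move=> _; rewrite big_nil; congr blade; apply/setP => a; rewrite !inE.
rewrite (path_sortedE ltn_trans) => /andP[a_lt s_sorted].
have {}a_lt b : b \in s -> (a < b)%N.
  by move=> bs; apply: (allP a_lt); rewrite map_f.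
rewrite big_cons IHs // bladeM /blade_sign big_set1 big1 => [|b].
  rewrite scale1r; congr blade; apply/setP => b; rewrite in_symdiff !inE.
  case: eqVneq => [->|//]; case: (boolP (a \in s)) => // /a_lt.
  by rewrite ltnn.
rewrite inE => /a_lt ab; rewrite /swap_sign ltnNge (ltnW ab) /=.
by case: eqP ab => [->|//]; rewrite ltnn.
Qed.

(* The factors of the product are taken in increasing order. *)
Lemma bladeE A : blade A = \prod_(a in A) gen a.
Proof.
rewrite -big_filter deprecated_filter_index_enum blade_prod_sorted.
  by congr blade; apply/setP => a; rewrite inE mem_enum.
rewrite sorted_map; apply: sorted_filter; first by move=> b a c; apply: ltn_trans.
by rewrite -enumT -sorted_map val_enum_ord iota_ltn_sorted.
Qed.

Definition grade_space (k : nat) : {vspace Cl} :=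
  <<[seq blade A | A in [set A : {set 'I_n} | #|A| == k]]>>%VS.

Definition noncentral_space : {vspace Cl} :=
  (\sum_(1 <= k < (n./2).*2.+1) grade_space k)%VS.

(* The projection onto grade 0, with values in the algebra. *)
Definition Tr U : Cl := U set0 *: 1.

Definition volume (g : 'I_n -> Cl) : Cl := \prod_(a < n) g a.

End Clifford.

Arguments gen F {p q} a.
Arguments cl_eta F {p q} a b.
Arguments noncentral_space F p q : clear implicits.

(* Loaded only here, since classical_sets shadows the finite-set constants. *)
From mathcomp Require Import complex.
From mathcomp Require Import all_classical all_reals all_analysis.
Import numFieldNormedType.Exports.

Variant scalar_kind := RealScalars | ComplexScalars.

Definition scalars (R : realType) (K : scalar_kind) : numFieldType :=
  match K with RealScalars => R | ComplexScalars => R[i] end.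

Definition re_part (R : realType) (K : scalar_kind) : scalars R K -> R :=
  match K with RealScalars => id | ComplexScalars => @complex.Re R end.

Definition im_part (R : realType) (K : scalar_kind) : scalars R K -> R :=
  match K with RealScalars => fun=> 0 | ComplexScalars => @complex.Im R end.

Section Curves.
Variables (R : realType) (K : scalar_kind) (p q : nat).
Local Notation n := (p + q)%N.
Local Notation F := (scalars R K).
Local Notation Cl := (clifford F p q).
Implicit Types (f S T C : R -> Cl) (h : 'I_n -> R -> Cl).

(* A complex-valued function of a real variable is differentiated through its
   real and imaginary parts. *)
Definition re_coord f (A : {set 'I_n}) : R -> R := fun x => re_part (f x A).
Definition im_coord f (A : {set 'I_n}) : R -> R := fun x => im_part (f x A).

Definition smooth_fun (g : R -> R) : Prop :=
  forall m x, derivable (derive1n m g) x 1.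

Definition smooth f : Prop :=
  forall A, smooth_fun (re_coord f A) /\ smooth_fun (im_coord f A).

Definition has_derivative f (x : R) (v : Cl) : Prop :=
  forall A, is_derive x 1 (re_coord f A) (re_part (v A)) /\
            is_derive x 1 (im_coord f A) (im_part (v A)).

Definition bracket (U W : Cl) : Cl := U * W - W * U.

Definition is_connection h C : Prop :=
  (forall x, C x \in noncentral_space F p q) /\
  (forall a x, exists2 dh, has_derivative (h a) x dh &
                           dh - bracket (C x) (h a x) = 0).

Definition is_invertible_solution C S : Prop :=
  (forall x, S x \is a GRing.unit) /\
  (forall x, has_derivative S x (C x * S x)).

(* h^{1...n} e_{1...n} *)
Definition volume_ratio h (x : R) : Cl :=
  volume (h^~ x) * (volume (gen F))^-1.

Definition transforms_to_gen h T : Prop :=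
  [/\ forall x, T x \is a GRing.unit,
      ~~ odd n -> forall a x, gen F a = (T x)^-1 * h a x * T x &
      odd n -> forall a x,
        gen F a = volume_ratio h x * (T x)^-1 * h a x * T x].

End Curves.

(* Main.v *)
(* By averaging over the basis blades, [T = \sum_A h^A U (e^A)^-1] intertwines two
   systems of generators, and its infinitesimal version
   [C1 = 2^-n \sum_A (h^A)' (h^A)^-1] is the connection. The transport [S' = C1 S]
   then makes [S^-1 h^a S] constant, so that one application of Pauli's theorem, at
   [x = 0], serves all [x]. When [n] is odd the centre need not be a field, and
   Pauli's theorem is proved on each block of the centre. The sign
   [h^{1...n} e_{1...n}] is constant because the central element [h^{1...n}] commutes
   with [C1]. *)
Require Import Defs.
From HB Require Import structures.
From mathcomp Require Import all_boot all_order all_algebra all_field.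
From mathcomp Require Import ring lra.
From mathcomp Require Import boolp.

Set Implicit Arguments.
Unset Strict Implicit.
Unset Printing Implicit Defensive.

Import Order.TTheory GRing.Theory Num.Theory.

Local Open Scope ring_scope.

(** * Clifford families and their ordered products *)

(** The products [blade_of g A] multiply, up to sign, as the sets [A] do under symmetric difference,
    with the same signs [blade_sign] for every Clifford family. Both averages rest on this: shifting
    the summation index by [B] produces the same sign in a blade and in an inverse blade, and the
    two cancel. The other tool is the coordinate at [set0], which is a trace; paired with inverse
    basis blades it reads off every coordinate.

    The obstacle is that an averaged intertwiner need not be invertible. But intertwiners in
    opposite directions compose to a central element, and a central element that is nonzero on every
    block of the centre can be inverted blockwise. For odd [n] the volume of the family must be
    [omega]: with volume [- omega] every such average is zero. The family is then negated, and this
    is the sign that the factor $h^{1\ldots n}e_{1\ldots n}$ records.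

    Invertibility of a transport comes from the adjoint equation, whose solution is a left inverse,
    and in finite dimension that suffices. *)

Lemma set_min_ind n (P : {set 'I_n} -> Prop) : P set0 ->
  (forall (a : 'I_n) (A : {set 'I_n}), (forall b, b \in A -> (a < b)%N) ->
    P A -> P (a |: A)) ->
  forall A, P A.
Proof.
move=> P0 PU A; have [m] := ubnP #|A|; elim: m A => // m IHm A /ltnSE Am.
have [->//|[a0 a0A]] := set_0Vmem A.
case: (arg_minnP (fun a : 'I_n => val a) a0A) => /= a aA amin.
rewrite -(setD1K aA); apply: PU => [b|]; last first.
  by apply: IHm; rewrite (leq_trans _ Am) // [X in (_ < X)%N](cardsD1 a) [a \in A]aA.
rewrite !inE => /andP[ba bA]; rewrite ltn_neqAle amin // andbT.
by apply: contra ba => /eqP/val_inj->.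
Qed.

Section CliffordFamilies.
Variables (F : numFieldType) (p q : nat).
Local Notation n := (p + q)%N.
Local Notation Cl := (clifford F p q).
Local Notation e := (@gen F p q).
Implicit Types (a b c : 'I_n) (A B C : {set 'I_n}) (U V W X Z : Cl) (g h : 'I_n -> Cl).

Definition clifford_family g :=
  forall a b, g a * g b + g b * g a = (2 * cl_eta F a b) *: 1.

Definition blade_of g A : Cl := \prod_(a in A) g a.

(** For a Clifford family [blade_of g A] squares to the sign [blade_sign F A A], so this is its
    inverse. The explicit form can be differentiated without touching the ring inverse. *)
Definition inv_blade_of g A : Cl := blade_sign F A A *: blade_of g A.

Lemma gen_family : clifford_family e.
Proof. exact: gen_anticomm. Qed.

Lemma blade_of_gen A : blade_of e A = blade F A.
Proof. by rewrite bladeE. Qed.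

Lemma volume_blade g : volume g = blade_of g setT.
Proof. by apply: eq_bigl => a; rewrite inE. Qed.

Lemma blade_of0 g : blade_of g set0 = 1.
Proof. by rewrite /blade_of big_set0. Qed.

Lemma blade_of1 g a : blade_of g [set a] = g a.
Proof. by rewrite /blade_of big_set1. Qed.

Lemma blade_of_min g a A : (forall b, b \in A -> (a < b)%N) ->
  blade_of g (a |: A) = g a * blade_of g A.
Proof.
move=> aA; rewrite /blade_of -[LHS]big_filter -[X in _ * X]big_filter.
rewrite !deprecated_filter_index_enum.
suff -> : enum (a |: A) = a :: enum A by rewrite big_cons.
have lt_sorted B : sorted ltn (map val (enum B)).
  rewrite sorted_map; apply: sorted_filter; first by move=> b c d; apply: ltn_trans.
  by rewrite -enumT -sorted_map val_enum_ord iota_ltn_sorted.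
apply: (inj_map val_inj); apply: (irr_sorted_eq ltn_trans ltnn) => //.
  rewrite /= path_sortedE; last exact: ltn_trans.
  by rewrite lt_sorted andbT; apply/allP => _ /mapP[b + ->]; rewrite mem_enum; apply: aA.
move=> b; apply/mapP/mapP => -[c + ->].
  by rewrite mem_enum !inE => cA; exists c; rewrite // inE mem_enum.
by rewrite inE mem_enum => cA; exists c; rewrite // mem_enum !inE.
Qed.

Lemma symdiff1 a A : a \notin A -> symdiff [set a] A = a |: A.
Proof.
move=> aA; apply/setP => b; rewrite in_symdiff !inE.
by case: eqP => [->|//]; rewrite (negPf aA).
Qed.

Lemma symdiffv A : symdiff A A = set0.
Proof. by apply/setP => a; rewrite in_symdiff addbb inE. Qed.

Lemma symdiffr0 A : symdiff A set0 = A.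
Proof. by rewrite symdiffC symdiff0. Qed.

Lemma blade_sign_sq A B : blade_sign F A B * blade_sign F A B = 1.
Proof. by rewrite -blade_signDl symdiffv blade_sign0l. Qed.

Lemma blade_sign11 a b : blade_sign F [set a] [set b] = swap_sign F a b.
Proof. by rewrite /blade_sign !big_set1. Qed.

Lemma swap_sign_lt (a b : 'I_n) : (a < b)%N -> swap_sign F a b = 1.
Proof.
move=> ab; rewrite /swap_sign ltnNge (ltnW ab) /=.
by case: eqP ab => [->|//]; rewrite ltnn.
Qed.

Lemma blade_sign_lt a A : (forall b, b \in A -> (a < b)%N) ->
  blade_sign F [set a] A = 1.
Proof. by move=> aA; rewrite /blade_sign big_set1 big1 // => b /aA/swap_sign_lt. Qed.

Section Family.
Variables (g : 'I_n -> Cl) (gP : clifford_family g).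

Lemma family_sq a : g a * g a = cl_eta F a a *: 1.
Proof.
apply: (scalerI (_ : 2 != 0 :> F)); first by rewrite pnatr_eq0.
by rewrite scalerA -gP scaler_nat mulr2n.
Qed.

Lemma family_swap a b : a != b -> g a * g b = - (g b * g a).
Proof.
by move=> /negPf ab; apply/eqP; rewrite -addr_eq0 gP /cl_eta ab mulr0 scale0r.
Qed.

(** The defining relations alone fix the multiplication table: [g a] is moved to the right past the
    smaller factors of [B] until it finds its place or meets its equal. *)
Lemma family_mul_blade a B :
  g a * blade_of g B = blade_sign F [set a] B *: blade_of g (symdiff [set a] B).
Proof.
elim/set_min_ind: B => [|b B bB IHB].
  by rewrite symdiffr0 blade_sign0r scale1r blade_of0 mulr1 blade_of1.
have nbB : b \notin B by apply/negP => /bB; rewrite ltnn.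
have signE : blade_sign F [set a] (b |: B) =
    swap_sign F a b * blade_sign F [set a] B.
  by rewrite -symdiff1 // blade_signDr blade_sign11.
case: (ltngtP a b) => [ab|ba|/val_inj ab].
- have abB c : c \in b |: B -> (a < c)%N.
    by rewrite !inE => /orP[/eqP->//|/bB]; apply: ltn_trans.
  rewrite blade_sign_lt // scale1r symdiff1 ?blade_of_min //.
  by apply/negP => /abB; rewrite ltnn.
- rewrite blade_of_min // mulrA family_swap ?mulNr -?mulrA ?IHB; last first.
    by apply: contraTneq ba => ->; rewrite ltnn.
  rewrite signE /swap_sign ba mulN1r scaleNr -scalerAr; congr (- (_ *: _)).
  have -> : symdiff [set a] (b |: B) = b |: symdiff [set a] B.
    apply/setP => c; rewrite !(in_symdiff, inE).
    case: (eqVneq c b) => [->|//]; case: eqP ba => [->|//]; by rewrite ltnn.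
  rewrite blade_of_min // => c; rewrite in_symdiff inE.
  by case: eqP => [->//|_] /bB.
- rewrite signE; subst b; rewrite blade_of_min ?mulrA ?family_sq //.
  rewrite blade_sign_lt // mulr1 /swap_sign ltnn eqxx -scalerAl mul1r.
  by rewrite -symdiff1 // symdiffK.
Qed.

Lemma blade_ofM A B :
  blade_of g A * blade_of g B = blade_sign F A B *: blade_of g (symdiff A B).
Proof.
elim/set_min_ind: A => [|a A aA IHA].
  by rewrite blade_of0 mul1r blade_sign0l symdiff0 scale1r.
have naA : a \notin A by apply/negP => /aA; rewrite ltnn.
rewrite blade_of_min // -mulrA IHA -scalerAr family_mul_blade scalerA.
rewrite -symdiff1 // symdiffA blade_signDl blade_signDr (blade_sign_lt aA) mul1r.
by rewrite mulrC.
Qed.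

Lemma blade_of_mulV A : blade_of g A * inv_blade_of g A = 1.
Proof.
by rewrite -scalerAr blade_ofM scalerA blade_sign_sq scale1r symdiffv blade_of0.
Qed.

Lemma blade_of_Vmul A : inv_blade_of g A * blade_of g A = 1.
Proof.
by rewrite -scalerAl blade_ofM scalerA blade_sign_sq scale1r symdiffv blade_of0.
Qed.

Lemma inv_blade_ofM A B : inv_blade_of g A * inv_blade_of g B =
  blade_sign F B A *: inv_blade_of g (symdiff B A).
Proof.
rewrite -[LHS]mulr1 -(blade_of_mulV (symdiff B A)).
rewrite -[blade_of g _]scale1r -(blade_sign_sq B A) -scalerA -blade_ofM.
rewrite -(scalerAl _ (_ * blade_of g A)) -(scalerAr _ (_ * inv_blade_of g B)).
congr (_ *: _); rewrite !mulrA.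
by rewrite -[_ * _ * blade_of g B]mulrA blade_of_Vmul mulr1 blade_of_Vmul mul1r.
Qed.

(** Each factor of the blade other than [g c] itself contributes one change of sign. *)
Lemma family_comm_blade c A :
  g c * blade_of g A = (-1) ^+ #|A :\ c| *: (blade_of g A * g c).
Proof.
rewrite -blade_of1 !blade_ofM scalerA symdiffC; congr (_ *: _).
suff <- : blade_sign F [set c] A * blade_sign F A [set c] = (-1) ^+ #|A :\ c|.
  by rewrite -mulrA blade_sign_sq mulr1.
rewrite /blade_sign big_set1 [X in _ * X](eq_bigr (fun a => swap_sign F a c)); last first.
  by move=> a _; rewrite big_set1.
rewrite -big_split /= -prodr_const big_mkcond [RHS]big_mkcond.
apply: eq_bigr => a _; rewrite !inE andbC; case: ifP => //= _.
case: (eqVneq a c) => [->|ac] /=; first exact: swap_sign_sq.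
rewrite /swap_sign [c == a]eq_sym (negPf ac).
by case: ltngtP ac => [_ _|_ _|/val_inj->]; rewrite ?mulr1 ?mul1r // eqxx.
Qed.

End Family.

(** Such a [c] gives a generator that anticommutes with the blade of [A]. If [#|A|] is even, any
    element of [A] works; if it is odd, any index outside [A]. *)
Lemma odd_setD1_exists A : A != set0 -> ~~ odd n || (A != setT) ->
  exists c, odd #|A :\ c|.
Proof.
case/set0Pn => a aA nA; case: (boolP (odd #|A|)) => [oA|eA].
  have /existsP[b bA] : [exists b, b \notin A].
    rewrite -negb_forall; apply: contraL nA => /forallP AT.
    have -> : A = setT by apply/setP => b; rewrite AT inE.
    rewrite eqxx orbF negbK; move: oA.
    have -> : A = setT by apply/setP => b; rewrite AT inE.
    by rewrite cardsT card_ord.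
  exists b; suff -> : A :\ b = A by [].
  by apply/setP => c; rewrite !inE; case: eqP => // ->; rewrite (negPf bA).
by exists a; move: eA; rewrite (cardsD1 a) aA /= negbK.
Qed.

(** Only equal blades contribute to grade 0, so this coordinate is a trace and is invariant under
    conjugation. *)
Lemma coef0C U V : (U * V) set0 = (V * U) set0.
Proof.
rewrite !ffunE; apply: eq_bigr => A _.
by rewrite symdiffr0 [U A * _]mulrC.
Qed.

Lemma coef0_conj g A U : clifford_family g ->
  (blade_of g A * U * inv_blade_of g A) set0 = U set0.
Proof. by move=> gP; rewrite coef0C mulrA blade_of_Vmul // mul1r. Qed.

Lemma coef0_inv_blade A U : (inv_blade_of e A * U) set0 = U A.
Proof.
rewrite !ffunE (bigD1 A) //= big1 ?addr0 => [|B BA].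
  rewrite symdiffr0 !ffunE blade_of_gen ffunE eqxx /GRing.scale /= mulr1.
  by rewrite mulrA blade_sign_sq mul1r.
by rewrite !ffunE blade_of_gen ffunE (negPf BA) /GRing.scale /= mulr0 mul0r mulr0.
Qed.

Lemma blade_sum U : U = \sum_A U A *: blade F A.
Proof.
apply/ffunP => B; rewrite sum_ffunE (bigD1 B) //= big1 ?addr0 => [|A AB].
  by rewrite !ffunE eqxx /GRing.scale /= mulr1.
by rewrite !ffunE eq_sym (negPf AB) /GRing.scale /= mulr0.
Qed.

(** Conjugation by an anticommuting generator negates the blade but preserves its trace, so the
    trace is its own opposite. *)
Lemma coef0_blade_of g A : clifford_family g ->
  A != set0 -> ~~ odd n || (A != setT) -> (blade_of g A) set0 = 0.
Proof.
move=> gP A0 An; have [c oc] := odd_setD1_exists A0 An.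
have := coef0_conj [set c] (blade_of g A) gP.
rewrite blade_of1 family_comm_blade // -signr_odd oc expr1 scaleN1r mulNr.
rewrite -mulrA -[g c](blade_of1 g c) blade_of_mulV // mulr1 ffunE.
by move/eqP; rewrite eq_sym -addr_eq0 -mulr2n mulrn_eq0 => /eqP.
Qed.

Definition central Z := forall U, U * Z = Z * U.

Lemma family_central g Z :
  (forall X, exists c : {set 'I_n} -> F, X = \sum_A c A *: blade_of g A) ->
  (forall a, g a * Z = Z * g a) -> central Z.
Proof.
move=> gX gZ X; have [c ->] := gX X.
rewrite mulr_suml mulr_sumr; apply: eq_bigr => A _.
rewrite -scalerAl -scalerAr; congr (_ *: _).
by apply/esym/commr_prod => a _; apply/esym/gZ.
Qed.

Lemma gen_central Z : (forall a, e a * Z = Z * e a) -> central Z.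
Proof.
apply: family_central => X; exists X; rewrite [LHS]blade_sum.
by apply: eq_bigr => A _; rewrite blade_of_gen.
Qed.

(** The coordinate is the trace of $(e^A)^{-1}Z$, and a generator anticommuting with $e^A$ negates
    this product under conjugation. *)
Lemma central_coef Z A : central Z -> A != set0 -> ~~ odd n || (A != setT) ->
  Z A = 0.
Proof.
move=> cZ A0 An; have [c oc] := odd_setD1_exists A0 An.
have := coef0_conj [set c] (inv_blade_of e A * Z) gen_family.
have iA : e c * inv_blade_of e A = - (inv_blade_of e A * e c).
  rewrite -scalerAr family_comm_blade; last exact: gen_family.
  by rewrite -signr_odd oc expr1 scaleN1r scalerN scalerAl.
rewrite blade_of1 mulrA iA !mulNr -(mulrA _ (e c)) cZ.
rewrite !mulrA -(mulrA _ (e c)) -[e c](blade_of1 e c).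
rewrite blade_of_mulV; last exact: gen_family.
rewrite mulr1 !coef0_inv_blade ffunE coef0_inv_blade.
by move/eqP; rewrite eq_sym -addr_eq0 -mulr2n mulrn_eq0 => /eqP.
Qed.
End CliffordFamilies.

(** * Averaging, the centre and the noncentral space *)

Section Averaging.
Variables (F : numFieldType) (p q : nat).
Local Notation n := (p + q)%N.
Local Notation Cl := (clifford F p q).
Local Notation e := (@gen F p q).
Local Notation omega := (blade F [set: 'I_n]).
Implicit Types (a b c : 'I_n) (A B C : {set 'I_n}) (U V W X Z : Cl) (g h : 'I_n -> Cl).

Lemma odd_setT_neq0 : odd n -> [set: 'I_n] != set0.
Proof.
move=> on; rewrite -card_gt0 cardsT card_ord.
by case: n on.
Qed.

Lemma top_blade_comm g c : clifford_family g -> odd n ->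
  g c * blade_of g setT = blade_of g setT * g c.
Proof.
move=> gP on; rewrite family_comm_blade //.
have := congr1 odd (cardsD1 c [set: 'I_n]).
rewrite inE cardsT card_ord on /= -signr_odd => /esym/negbTE->.
by rewrite expr0 scale1r.
Qed.

Lemma omega_central : odd n -> central omega.
Proof.
move=> on; apply: gen_central => a; rewrite -blade_of_gen.
by apply: top_blade_comm => //; apply: gen_family.
Qed.

Lemma central_eq Z : central Z ->
  Z = Z set0 *: 1 + (if odd n then Z setT *: omega else 0).
Proof.
move=> cZ; apply/ffunP => A; rewrite !ffunE.
have -> : (if odd n then Z setT *: omega else 0) A =
    if odd n then Z setT * (A == setT)%:R else 0.
  by case: ifP; rewrite !ffunE.
rewrite /GRing.scale /=; case: (eqVneq A set0) => [->|A0].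
  case: ifP => [/odd_setT_neq0|_]; last by rewrite mulr1 addr0.
  by rewrite eq_sym => /negPf->; rewrite mulr0 mulr1 addr0.
rewrite mulr0 add0r; case: ifPn => on; last by rewrite central_coef ?on.
case: eqVneq => [->|AT]; first by rewrite mulr1.
by rewrite mulr0 central_coef // AT orbT.
Qed.

Lemma central_eq0 Z : central Z -> Z set0 = 0 -> (odd n -> Z setT = 0) -> Z = 0.
Proof.
move=> cZ Z0 ZT; rewrite (central_eq cZ) Z0 scale0r add0r.
by case: ifP => // /ZT->; rewrite scale0r.
Qed.

(** [(n./2).*2] is [n] for even [n] and [n - 1] for odd [n], so the grades left out are 0 and, for
    odd [n], also [n]; each of these two is spanned by a single blade. *)
Lemma noncentralP U :
  U \in noncentral_space F p q <-> U set0 = 0 /\ (odd n -> U setT = 0).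
Proof.
split=> [UN|[U0 UT]].
  have coef0 A : (forall k, (1 <= k < (n./2).*2.+1)%N -> #|A| != k) -> U A = 0.
    move=> Ak; move: UN; rewrite /noncentral_space big_nat.
    have: forall V, V \in (\sum_(1 <= k < (n./2).*2.+1 | (1 <= k < (n./2).*2.+1)%N)
      grade_space F p q k)%VS -> V A = 0; last by apply.
    elim/big_ind: _ => [V|V1 V2 IH1 IH2 V|k /Ak Ank V].
    - by rewrite memv0 => /eqP->; rewrite ffunE.
    - by case/memv_addP => v1 /IH1 v10 [v2 /IH2 v20 ->]; rewrite ffunE v10 v20 addr0.
    rewrite /grade_space span_def big_map big_seq.
    move: V; elim/big_ind: _ => [V|V1 V2 IH1 IH2 V|B].
    - by rewrite memv0 => /eqP->; rewrite ffunE.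
    - by case/memv_addP => v1 /IH1 v10 [v2 /IH2 v20 ->]; rewrite ffunE v10 v20 addr0.
    rewrite mem_enum inE => /eqP Bk V /vlineP[x ->]; rewrite !ffunE.
    by case: eqP => [AB|_]; [move: Ank; rewrite AB Bk eqxx|rewrite scaler0].
  split=> [|on]; apply: coef0 => k /andP[k0 kn].
    by rewrite cards0 neq_ltn k0.
  by rewrite cardsT card_ord neq_ltn orbC (leq_trans kn) // -[leqRHS]odd_double_half on.
rewrite (blade_sum U); apply: memv_suml => A _.
have [->|UA] := eqVneq (U A) 0; first by rewrite scale0r mem0v.
apply: memvZ; have AgA : blade F A \in grade_space F p q #|A|.
  by apply: memv_span; apply/mapP; exists A => //; rewrite mem_enum inE.
apply: subvP AgA; rewrite /noncentral_space (big_rem #|A|) /= ?addvSl // mem_index_iota.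
rewrite card_gt0 ltnS; apply/andP; split.
  by apply: contraNneq UA => ->; rewrite U0.
case: (boolP (odd n)) => on; last first.
  rewrite -[X in (_ <= X)%N]/(false + _)%N -(negPf on) odd_double_half.
  by rewrite -[X in (_ <= X)%N]card_ord max_card.
rewrite -ltnS -[X in (_ <= X)%N]/(true + _)%N -on odd_double_half.
rewrite -[X in (_ < X)%N]card_ord -cardsT proper_card //.
by rewrite properT; apply: contraNneq UA => ->; rewrite UT.
Qed.

(** Left multiplication by [U] is injective, hence onto by finite dimension, and a preimage of 1 is
    a right inverse. *)
Lemma left_inverse_unit U V : V * U = 1 -> U \is a GRing.unit.
Proof.
move=> VU; have inj : lker (amull U) == 0%VS.
  apply/lker0P => x y /(congr1 ( *%R V)); rewrite !lfunE /= => VUxy.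
  by rewrite -[x](@mul1r Cl) -[y](@mul1r Cl) -VU -!(@mulrA Cl).
have /memv_imgP[W _] : 1 \in limg (amull U) by rewrite lker0_limgf // memvf.
rewrite lfunE /= => UW; apply/unitrP; exists V; split=> //.
by have -> : V = W; rewrite ?UW // -[V]mulr1 UW mulrA VU mul1r.
Qed.

(** Distinct blades of the family are orthogonal for the trace pairing with inverse blades, hence
    independent, and there are as many of them as the dimension. For odd [n] complementary blades
    pair to a multiple of the trace of the volume, which is where the extra hypothesis enters. *)
Lemma family_spans g : clifford_family g ->
  (odd n -> volume g set0 = 0) ->
  forall X, exists c : {set 'I_n} -> F, X = \sum_A c A *: blade_of g A.
Proof.
move=> gP gT X.
pose f U : Cl := \sum_A U A *: blade_of g A.
have f_lin : linear f.
  move=> k U V; rewrite /f scaler_sumr -big_split; apply: eq_bigr => A _ /=.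
  by rewrite !ffunE scalerDl scalerA.
pose fL := GRing.isLinear.Build F Cl Cl *:%R f f_lin.
pose f' : {linear Cl -> Cl} := HB.pack f fL.
have fE U B : (inv_blade_of g B * f U) set0 = U B.
  rewrite /f mulr_sumr sum_ffunE (bigD1 B) //= big1 ?addr0 => [|A AB].
    by rewrite -scalerAr blade_of_Vmul // !ffunE eqxx /GRing.scale /= mulr1.
  rewrite -scalerAr -scalerAl blade_ofM // !ffunE.
  suff -> : blade_of g (symdiff B A) set0 = 0 by rewrite !scaler0.
  case: (boolP (odd n && (symdiff B A == setT))) => [/andP[on /eqP->]|].
    by rewrite -volume_blade gT.
  rewrite negb_and => oBA; apply: coef0_blade_of => //.
  by apply: contra AB => /eqP BA; rewrite -(symdiffK B A) BA symdiffr0.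
have inj : lker (linfun f') == 0%VS.
  apply/lker0P => U V; rewrite !lfunE /= => UV.
  by apply/ffunP => B; rewrite -(fE U) -(fE V); rewrite /= in UV; rewrite UV.
have /memv_imgP[U _] : X \in limg (linfun f') by rewrite lker0_limgf // memvf.
by rewrite lfunE => ->; exists U.
Qed.

(** The volume commutes with a family that spans, so it is central; having trace zero it is a
    multiple of [omega]. Both have the same square, so the coefficient squares to 1. *)
Lemma volume_sign g : clifford_family g -> odd n -> Tr (volume g) = 0 ->
  volume g = omega \/ volume g = - omega.
Proof.
move=> gP on /(congr1 (fun U : Cl => U set0)).
rewrite !ffunE eqxx [_ *: _]mulr1 => g0; rewrite volume_blade.
set H := blade_of g setT.
have H0 : H set0 = 0 by rewrite /H -volume_blade.
have cH : central H.
  apply: family_central (family_spans gP (fun _ => g0)) _ => a.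
  exact: top_blade_comm.
have HE : H = H setT *: omega by rewrite [LHS]central_eq // H0 scale0r add0r on.
have : H * H = omega * omega.
  rewrite /H -blade_of_gen !blade_ofM ?symdiffv ?blade_of0 //; exact: gen_family.
rewrite {1 2}HE -scalerAl -scalerAr scalerA bladeM symdiffv scalerA.
move/(congr1 (fun U : Cl => U set0)); rewrite !ffunE eqxx [_ *: _]mulr1 [_ *: _]mulr1.
move/(congr1 ( *%R^~ (blade_sign F [set: 'I_n] [set: 'I_n]))).
rewrite /= -!mulrA !blade_sign_sq mulr1.
move/eqP; rewrite -expr2 sqrf_eq1 => /orP[]/eqP h; rewrite HE h.
  by left; rewrite scale1r.
by right; rewrite scaleN1r.
Qed.

Definition avg g h U : Cl := \sum_A blade_of g A * U * inv_blade_of h A.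

(** Conjugating the sum by the blades of [B] permutes its terms through [symdiff B]. *)
Lemma avg_intertwine g h U B : clifford_family g -> clifford_family h ->
  blade_of g B * avg g h U = avg g h U * blade_of h B.
Proof.
move=> gP hP; suff avgE : blade_of g B * avg g h U * inv_blade_of h B = avg g h U.
  by rewrite -[in RHS]avgE -!mulrA blade_of_Vmul // mulr1.
rewrite /avg mulr_sumr mulr_suml [RHS](reindex_inj (inv_inj (symdiffK B))) /=.
apply: eq_bigr => A _; rewrite !mulrA blade_ofM //.
rewrite -(mulrA _ (inv_blade_of h A)) inv_blade_ofM //.
rewrite -!(scalerAl (blade_sign F B A)) -scalerAr scalerA blade_sign_sq.
by rewrite scale1r.
Qed.

Lemma avg_gen_central U : central (avg e e U).
Proof.
apply: gen_central => a; rewrite -blade_of1.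
by apply: avg_intertwine; apply: gen_family.
Qed.

(** The average is central, so only two coordinates have to be checked, and both are traces that
    conjugation preserves. *)
Lemma avg_gen_eq0 U : U set0 = 0 -> (odd n -> U setT = 0) -> avg e e U = 0.
Proof.
move=> U0 UT; apply: central_eq0; first exact: avg_gen_central.
  rewrite sum_ffunE big1 // => A _; rewrite coef0_conj //; exact: gen_family.
move=> on; rewrite -coef0_inv_blade /avg mulr_sumr sum_ffunE big1 // => A _.
have cT : central (inv_blade_of e setT).
  move=> V; rewrite -scalerAl -scalerAr blade_of_gen omega_central //.
rewrite !mulrA -cT -(mulrA _ _ U) coef0_conj ?coef0_inv_blade ?UT //.
exact: gen_family.
Qed.

Lemma central_mul_avg g h Z U : central Z -> Z * avg g h U = avg g h (Z * U).
Proof.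
move=> cZ; rewrite /avg mulr_sumr; apply: eq_bigr => A _.
by rewrite !mulrA cZ.
Qed.

Lemma avg_gen_id Z : central Z -> avg e e Z = #|{: {set 'I_n}}|%:R *: Z.
Proof.
move=> cZ; rewrite /avg -sum1_card natr_sum scaler_suml; apply: eq_bigr => A _.
rewrite cZ -mulrA blade_of_mulV ?mulr1 ?scale1r //; exact: gen_family.
Qed.

Lemma card_set_neq0 : #|{: {set 'I_n}}|%:R != 0 :> F.
Proof. by rewrite pnatr_eq0 -lt0n; apply/card_gt0P; exists set0. Qed.

End Averaging.

(** * Pauli's theorem *)

Section Pauli.
Variables (F : numFieldType) (p q : nat).
Local Notation n := (p + q)%N.
Local Notation Cl := (clifford F p q).
Local Notation e := (@gen F p q).
Local Notation omega := (blade F [set: 'I_n]).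
Local Notation N := (#|{: {set 'I_n}}|%:R : F).
Implicit Types (a b c : 'I_n) (A B C : {set 'I_n}) (U V W X Z : Cl) (g h : 'I_n -> Cl).

Lemma central1 : central (1 : Cl).
Proof. by move=> U; rewrite mulr1 mul1r. Qed.

Lemma inv_blade_of0 : inv_blade_of e set0 = 1.
Proof. by rewrite /inv_blade_of blade_sign0l blade_of0 scale1r. Qed.

Lemma coef0_avg U : (avg e e U) set0 = N * U set0.
Proof.
rewrite /avg sum_ffunE -sum1_card natr_sum mulr_suml; apply: eq_bigr => A _.
by rewrite coef0_conj ?mul1r //; apply: gen_family.
Qed.

Lemma omega_inv_central : odd n -> central (inv_blade_of e setT).
Proof.
by move=> on V; rewrite -scalerAl -scalerAr blade_of_gen omega_central.
Qed.

(* Hence the intertwiners [avg g e (blade F B)] do not all vanish on any block of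
   the centre. *)
Lemma sum_avg_blade g : (odd n -> volume g = omega) ->
  \sum_B avg g e (blade F B) * inv_blade_of e B = (N * (1 + odd n)%:R) *: 1.
Proof.
move=> gT; under eq_bigr => B _ do rewrite mulr_suml.
rewrite exchange_big /=.
(* After the exchange the inner sum averages over the generators and depends on [A] only through
   $(e^A)^{-1}$, so it vanishes unless $e^A$ is central. *)
have -> : \sum_A \sum_B blade_of g A * blade F B * inv_blade_of e A * inv_blade_of e B
    = \sum_A blade_of g A * avg e e (inv_blade_of e A).
  apply: eq_bigr => A _; rewrite /avg mulr_sumr; apply: eq_bigr => B _.
  by rewrite blade_of_gen !mulrA.
have avg0 A : A != set0 -> ~~ (odd n && (A == setT)) ->
    blade_of g A * avg e e (inv_blade_of e A) = 0.
  move=> A0 AT; rewrite avg_gen_eq0 ?mulr0 // => [|on].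
    by rewrite !ffunE blade_of_gen ffunE eq_sym (negPf A0) scaler0.
  rewrite !ffunE blade_of_gen ffunE eq_sym; move: AT; rewrite on /= => /negPf->.
  by rewrite scaler0.
rewrite (bigD1 set0) //= inv_blade_of0 blade_of0 mul1r avg_gen_id; last exact: central1.
case: (boolP (odd n)) => on; last first.
  by rewrite big1 ?addr0 ?mulr1 // => A A0; rewrite avg0 // (negPf on).
rewrite (bigD1 setT) /=; last exact: odd_setT_neq0.
rewrite big1 ?addr0 => [|A /andP[A0 AT]]; last by rewrite avg0 // (negPf AT) andbF.
rewrite avg_gen_id; last exact: omega_inv_central.
(* The normalisation [volume g = omega] makes the top term equal to the term at [set0]; with the
   opposite sign they would cancel. *)
rewrite -volume_blade gT // -scalerAr -blade_of_gen blade_of_mulV; last exact: gen_family.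
by rewrite -scalerDl mulr_natr mulr2n.
Qed.

(* [P] is the system of primitive idempotents of the centre. The averaged
   intertwiner must be nonzero on each block [P i], which is why its argument is
   chosen blockwise. *)
Lemma intertwiner_of_idempotents (I : finType) (P : I -> Cl) g :
  clifford_family g -> (odd n -> volume g = omega) ->
  (forall i, central (P i)) -> (forall i j, P i * P j = if i == j then P i else 0) ->
  \sum_i P i = 1 -> (forall i, P i != 0) ->
  (forall i Z, central Z -> P i * Z != 0 -> exists2 W, central W & W * (P i * Z) = P i) ->
  exists2 T, T \is a GRing.unit & forall a, g a * T = T * e a.
Proof.
move=> gP gT cP PP P1 P0 Pinv.
(* If every intertwiner vanished on block [i], so would their weighted sum, a nonzero multiple of 1,
   and [P i] would be 0. *)
have /choice[B BP] i : exists B, P i * avg g e (blade F B) != 0.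
  apply: contrapT => /forallNP PB.
  have : P i * \sum_B avg g e (blade F B) * inv_blade_of e B = 0.
    rewrite mulr_sumr big1 // => B _; rewrite mulrA.
    by have /negP := PB B; rewrite negbK => /eqP->; rewrite mul0r.
  rewrite sum_avg_blade // -scalerAr mulr1 => /eqP.
  rewrite scaler_eq0 (negPf (P0 i)) orbF mulf_eq0 (negPf (card_set_neq0 _ _ _)).
  by rewrite pnatr_eq0.
pose T := avg g e (\sum_i P i * blade F (B i)).
have TP C : blade_of g C * T = T * blade_of e C.
  by apply: avg_intertwine => //; apply: gen_family.
have TPV C : inv_blade_of g C * T = T * inv_blade_of e C.
  by rewrite -scalerAl TP -scalerAr.
have PT i : P i * T = P i * avg g e (blade F (B i)).
  rewrite /T central_mul_avg // mulr_sumr (bigD1 i) //= big1 ?addr0 => [|j ji].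
    by rewrite mulrA PP eqxx central_mul_avg.
  by rewrite mulrA PP eq_sym (negPf ji) mul0r.
have /choice[G GP] i : exists C, (P i * T) C != 0.
  apply: contrapT => /forallNP PC.
  move: (BP i); rewrite -PT => /eqP; apply; apply/ffunP => C; rewrite [RHS]ffunE.
  by have /negP := PC C; rewrite negbK => /eqP.
(* [z i] is central, is nonzero because its trace is [N] times a nonzero coordinate of [P i * T],
   and has [T] as a right factor. Inverting each [z i] on its block therefore produces a left
   inverse of [T]. *)
pose z i := avg e e (inv_blade_of e (G i) * (P i * T)).
have z0 i : P i * z i != 0.
  have -> : P i * z i = z i.
    rewrite /z central_mul_avg // (mulrA (P i)) -(cP i (inv_blade_of _ _)).
    by rewrite -mulrA (mulrA (P i) (P i)) PP eqxx.
  apply: contra (GP i) => /eqP/(congr1 (fun V : Cl => V set0)).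
  rewrite coef0_avg coef0_inv_blade (ffunE (fun=> 0) set0) => /eqP.
  by rewrite mulf_eq0 (negPf (card_set_neq0 _ _ _)).
have zT i : z i = avg e g (inv_blade_of e (G i) * P i) * T.
  rewrite /z /avg mulr_suml; apply: eq_bigr => A _.
  by rewrite -!mulrA TPV.
have /choice[W WP] i : exists W, W * (P i * z i) = P i.
  by have [W _ WP] := Pinv i (z i) (avg_gen_central _) (z0 i); exists W.
exists T; last by move=> a; rewrite -!blade_of1 TP.
apply: (@left_inverse_unit _ _ _ _
  (\sum_i W i * (P i * avg e g (inv_blade_of e (G i) * P i)))).
rewrite mulr_suml -P1; apply: eq_bigr => i _.
by rewrite -!mulrA -zT.
Qed.

(** The case of a centre that is a field: a single block, with idempotent 1. *)
Lemma trivial_idempotent g : clifford_family g -> (odd n -> volume g = omega) ->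
  (forall Z, central Z -> Z != 0 -> exists2 W, central W & W * Z = 1) ->
  exists2 T, T \is a GRing.unit & forall a, g a * T = T * e a.
Proof.
move=> gP gT Zinv; apply: (@intertwiner_of_idempotents unit (fun=> 1)) => //.
- by move=> _; apply: central1.
- by move=> [] []; rewrite mulr1.
- by rewrite big_const card_unit /= addr0.
- by move=> _; apply: oner_neq0.
- by move=> _ Z; rewrite mul1r; apply: Zinv.
Qed.

Lemma central_add Z W : central Z -> central W -> central (Z + W).
Proof. by move=> cZ cW U; rewrite mulrDr mulrDl cZ cW. Qed.

Lemma central_scale (k : F) Z : central Z -> central (k *: Z).
Proof. by move=> cZ U; rewrite -scalerAl -scalerAr cZ. Qed.

(** The centre is [F] for even [n], and for odd [n] it is [F] with a square root [omega] of [s2]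
    adjoined: a field if [s2] is not a square in [F], and a product of two copies of [F]
    otherwise. *)
Lemma pauli_intertwiner g : clifford_family g -> (odd n -> volume g = omega) ->
  exists2 T, T \is a GRing.unit & forall a, g a * T = T * e a.
Proof.
move=> gP gT; case: (boolP (odd n)) => on; last first.
  apply: trivial_idempotent => // Z cZ; rewrite (central_eq cZ) (negPf on) addr0.
  rewrite scaler_eq0 negb_or => /andP[Z0 _]; exists ((Z set0)^-1 *: 1).
    exact/central_scale/central1.
  by rewrite -scalerAl mul1r scalerA mulVf // scale1r.
have co : central omega := omega_central on.
have Zeq Z : central Z -> Z = Z set0 *: 1 + Z setT *: omega.
  by move=> cZ; rewrite {1}(central_eq cZ) on.
pose s2 := blade_sign F [set: 'I_n] [set: 'I_n].
have oo : omega * omega = s2 *: 1.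
  by rewrite bladeM symdiffv.
have s20 : s2 != 0.
  by apply/eqP => s0; have := blade_sign_sq F [set: 'I_n] [set: 'I_n];
    rewrite -/s2 s0 mul0r => /eqP; rewrite eq_sym oner_eq0.
have mulZ (x y u v : F) : (x *: 1 + y *: omega) * (u *: 1 + v *: omega) =
    (x * u + y * v * s2) *: 1 + (x * v + y * u) *: omega :> Cl.
  rewrite mulrDl !mulrDr -!scalerAl -!scalerAr !mul1r !mulr1 oo !scalerA.
  rewrite [X in _ + X = _]addrC addrACA -!scalerDl.
  by congr (_ *: _ + _ *: _); ring.
have [[s sE]|ns] := pselect (exists s : F, s ^+ 2 = s2); last first.
  apply: trivial_idempotent => // Z cZ.
  rewrite (Zeq Z cZ); set x := Z set0; set y := Z setT => Z0.
  (* The norm of [x + y omega]; the inverse below is the conjugate divided by it. *)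
  have D0 : x ^+ 2 - y ^+ 2 * s2 != 0.
    apply/eqP => /eqP; rewrite subr_eq0 => /eqP xy.
    have y0 : y != 0.
      apply: contraNneq Z0 => y0; move: xy; rewrite y0 expr0n mul0r => /eqP.
      by rewrite sqrf_eq0 => /eqP->; rewrite !scale0r addr0.
    by apply: ns; exists (x / y); rewrite expr_div_n xy [_ * s2]mulrC mulfK // sqrf_eq0.
  exists ((x / (x ^+ 2 - y ^+ 2 * s2)) *: 1 + (- y / (x ^+ 2 - y ^+ 2 * s2)) *: omega).
    by apply: central_add; apply: central_scale => //; apply: central1.
  rewrite mulZ [X in X *: 1](_ : _ = 1); last by field.
  by rewrite [X in X *: omega](_ : _ = 0) ?scale0r ?scale1r ?addr0 //; field.
have s0 : s != 0 by apply: contraNneq s20 => s0; rewrite -sE s0 expr0n.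
pose sg (b : bool) : F := (-1) ^+ b.
have sg2 (b : bool) : sg b * sg b = 1 by rewrite /sg -signr_addb addbb.
(* The two idempotents $(1 \pm \omega/s)/2$; multiplying by one of them evaluates [omega] at [s] or
   at [- s]. *)
pose P (b : bool) : Cl := 2^-1 *: 1 + (sg b / (2 * s)) *: omega.
have n2 : (2 : F) != 0 by rewrite pnatr_eq0.
have PZ (b : bool) (x y : F) : P b * (x *: 1 + y *: omega) = (x + sg b * s * y) *: P b.
  rewrite /P mulZ scalerDr !scalerA -sE; congr (_ *: _ + _ *: _).
    by field; rewrite s0.
  transitivity (2^-1 * (sg b * sg b * y + sg b / s * x)); last by field; rewrite s0.
  by rewrite sg2; field; rewrite s0.
have P0 (b : bool) : P b != 0.
  apply/eqP => /(congr1 (fun V : Cl => V set0)).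
  rewrite !ffunE eqxx eq_sym (negPf (odd_setT_neq0 on)) scaler0 addr0 => /eqP.
  by rewrite [_ *: _]mulr1 invr_eq0 (negPf n2).
apply: (@intertwiner_of_idempotents bool P) => //.
- by move=> b; apply: central_add; apply: central_scale => //; apply: central1.
- move=> b d; rewrite {2}/P PZ.
  case: eqP => [<-|bd].
    rewrite [X in X *: _](_ : _ = 2^-1 * (1 + sg b * sg b)); last by field; rewrite s0.
    by rewrite sg2 -mulr2n -[1 *+ 2]/(2 : F) mulVf // scale1r.
  rewrite [X in X *: _](_ : _ = 0) ?scale0r //.
  transitivity (2^-1 * (1 + sg b * sg d)); first by field; rewrite s0.
  rewrite /sg; case: b d bd => [] [] //= _;
    by rewrite expr0 expr1 ?mulr1 ?mul1r subrr mulr0.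
- rewrite big_bool /= /P /sg expr0 expr1 addrACA -!scalerDl.
  rewrite [X in X *: 1](_ : _ = 1); last by field.
  by rewrite [X in X *: omega](_ : _ = 0) ?scale1r ?scale0r ?addr0 //; field; rewrite s0.
- move=> b Z cZ; rewrite (Zeq Z cZ) PZ scaler_eq0 negb_or => /andP[k0 _].
  exists ((Z set0 + sg b * s * Z setT)^-1 *: 1); first exact/central_scale/central1.
  by rewrite -scalerAl mul1r scalerA mulVf // scale1r.
Qed.

End Pauli.

(** * Pauli's theorem in each parity, and the connection at a fixed point *)

Section PointwiseConnection.
Variables (F : numFieldType) (p q : nat).
Local Notation n := (p + q)%N.
Local Notation Cl := (clifford F p q).
Local Notation e := (@gen F p q).
Local Notation omega := (blade F [set: 'I_n]).
Local Notation N := (#|{: {set 'I_n}}|%:R : F).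
Implicit Types (a b c : 'I_n) (A B C : {set 'I_n}) (U V W X Z : Cl) (g h : 'I_n -> Cl).

Lemma Tr_coef0 U : Tr U = 0 -> U set0 = 0.
Proof.
move/(congr1 (fun V : Cl => V set0)); rewrite /Tr !ffunE eqxx.
by rewrite [_ *: _]mulr1.
Qed.

Lemma volume_gen : volume e = omega.
Proof. by rewrite volume_blade blade_of_gen. Qed.

Lemma omega_unit : omega \is a GRing.unit.
Proof.
apply: (@left_inverse_unit _ _ _ _ (inv_blade_of e setT)).
by rewrite -blade_of_gen blade_of_Vmul //; apply: gen_family.
Qed.

Lemma clifford_family_opp g : clifford_family g -> clifford_family (fun a => - g a).
Proof. by move=> gP a b; rewrite !mulrNN. Qed.

Lemma volume_opp g : odd n -> volume (fun a => - g a) = - volume g.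
Proof.
by move=> on; rewrite /volume prodrN card_ord -signr_odd on expr1 mulN1r.
Qed.

Lemma pauli_even g : ~~ odd n -> clifford_family g ->
  exists2 T, T \is a GRing.unit & forall a, g a * T = T * e a.
Proof. by move=> /negPf on gP; apply: pauli_intertwiner => //; rewrite on. Qed.

(** If the volume is [- omega], the negated family has volume [omega] because [n] is odd, and the
    ratio [-1] in front of [g a] performs this negation. *)
Lemma pauli_odd g : odd n -> clifford_family g -> Tr (volume g) = 0 ->
  exists2 T, T \is a GRing.unit &
    forall a, volume g * omega^-1 * g a * T = T * e a.
Proof.
move=> on gP gT.
have [gE|gE] := volume_sign gP on gT; rewrite gE ?mulNr divrr ?omega_unit //.
  have [T Tu TP] := pauli_intertwiner gP (fun=> gE).
  by exists T => // a; rewrite mul1r.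
have [|T Tu TP] := pauli_intertwiner (clifford_family_opp gP).
  by rewrite volume_opp // gE opprK.
by exists T => // a; rewrite mulN1r.
Qed.

Lemma family_commutant g Z : clifford_family g ->
  (odd n -> Tr (volume g) = 0) -> (forall a, g a * Z = Z * g a) -> central Z.
Proof.
move=> gP gT; apply: family_central; apply: family_spans => // on.
exact/Tr_coef0/gT.
Qed.

Lemma noncentral_central_eq0 Z : central Z -> Z \in noncentral_space F p q -> Z = 0.
Proof. by move=> cZ /noncentralP[Z0 ZT]; apply: central_eq0. Qed.

(* [D A] plays the derivative of [blade_of g A]. If [D A = [C, blade_of g A]] for
   some [C], then the average below is [C] minus its central part. *)
Section Connection.
Variables (g : 'I_n -> Cl) (gP : clifford_family g) (D : {set 'I_n} -> Cl).
(** Leibniz's rule for the multiplication table [blade_ofM], whose signs are constants. *)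
Hypothesis DM : forall A B,
  D A * blade_of g B + blade_of g A * D B = blade_sign F A B *: D (symdiff A B).

Definition connection_of : Cl := N^-1 *: \sum_A D A * inv_blade_of g A.

Lemma connection_ofP B :
  D B = connection_of * blade_of g B - blade_of g B * connection_of.
Proof.
have N0 : N != 0 by apply: card_set_neq0.
pose Y := \sum_A D A * inv_blade_of g A.
(* Reindexing by [symdiff B] and applying Leibniz's rule splits each term in two: one is the same
   for all [A] and gives the factor [N], the other is conjugated by the blade of [B]. Multiplied by
   that blade on the right, this is the claim. *)
have YE : N *: (D B * inv_blade_of g B) + blade_of g B * Y * inv_blade_of g B = Y.
  rewrite {2}/Y (reindex_inj (inv_inj (symdiffK B))) /= /Y.
  rewrite -sum1_card natr_sum scaler_suml mulr_sumr mulr_suml -big_split.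
  apply: eq_bigr => A _ /=; rewrite scale1r.
  rewrite -[LHS]scale1r -(blade_sign_sq F B A) -scalerA.
  have -> : D (symdiff B A) =
      blade_sign F B A *: (D B * blade_of g A + blade_of g B * D A).
    by rewrite DM scalerA blade_sign_sq scale1r.
  rewrite -[RHS]scalerAl; congr (_ *: _).
  have -> : inv_blade_of g (symdiff B A) =
      blade_sign F B A *: (inv_blade_of g A * inv_blade_of g B).
    by rewrite inv_blade_ofM // scalerA blade_sign_sq scale1r.
  rewrite -[RHS]scalerAr; congr (_ *: _).
  by rewrite mulrDl !mulrA -(mulrA _ (blade_of g A)) blade_of_mulV // mulr1.
apply: (scalerI N0); rewrite /connection_of -/Y scalerBr.
rewrite -(scalerAl _ Y) -(scalerAr _ (blade_of g B)) !scalerA divff // !scale1r.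
by rewrite -{1}YE mulrDl -(mulrA _ (inv_blade_of g B)) blade_of_Vmul // mulr1 addrK
  -(scalerAl _ (_ * _)) -mulrA blade_of_Vmul // mulr1.
Qed.

(** The square of a blade is constant, so [D A] anticommutes with [blade_of g A], and their product
    has trace zero even against a central factor. The factors 1 and $\omega^{-1}$ give the two
    coordinates that must vanish. *)
Lemma connection_of_noncentral : connection_of \in noncentral_space F p q.
Proof.
have D0 : D set0 = 0.
  have := DM set0 set0; rewrite symdiffv blade_sign0l scale1r blade_of0 mul1r mulr1.
  by move/eqP; rewrite -subr_eq0 addrK => /eqP.
have coef0 Z A : central Z -> (Z * (D A * inv_blade_of g A)) set0 = 0.
  move=> cZ; suff E : (Z * (D A * blade_of g A)) set0 = 0.
    by rewrite -!scalerAr ffunE E scaler0.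
  have := DM A A; rewrite symdiffv D0 scaler0.
  move/(congr1 (fun U : Cl => (Z * U) set0)); rewrite mulrDr ffunE.
  have -> : (Z * (blade_of g A * D A)) set0 = (Z * (D A * blade_of g A)) set0.
    by rewrite mulrA -cZ -mulrA coef0C mulrA.
  rewrite mulr0 (ffunE (fun=> 0) set0) -mulr2n => /eqP.
  by rewrite mulrn_eq0 => /eqP.
apply/noncentralP; split=> [|on].
  rewrite ffunE sum_ffunE big1 ?scaler0 // => A _.
  by rewrite -[_ * _]mul1r coef0 //; apply: central1.
rewrite -coef0_inv_blade -scalerAr mulr_sumr ffunE sum_ffunE big1 ?scaler0 // => A _.
by rewrite coef0 //; apply: omega_inv_central.
Qed.

End Connection.
End PointwiseConnection.

(* Loaded only here, since classical_sets shadows the finite-set constants. *)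
From mathcomp Require Import complex.
From mathcomp Require Import all_classical all_reals all_analysis.
Import numFieldNormedType.Exports.

(** * Linear ordinary differential equations *)

Section LinearODE.
Variable R : realType.
Implicit Types (f F df : R -> R).

Lemma is_derive_continuous f (x d : R) : is_derive x 1 f d -> {for x, continuous f}.
Proof. by case=> + _; move/derivable1_diffP/differentiable_continuous. Qed.

Lemma derive_ge0_le f df (a b : R) : a <= b ->
  (forall t, a <= t <= b -> is_derive t 1 f (df t)) ->
  (forall t, a <= t <= b -> 0 <= df t) -> f a <= f b.
Proof.
move=> ab fdf df0; have [||c cab] := @MVT_segment _ f df _ _ ab.
- by move=> t tab; apply: fdf; move: tab; rewrite in_itv /= => /andP[/ltW-> /ltW->].
- apply/continuous_in_subspaceT => t; rewrite inE /= in_itv /= => tab.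
  exact: is_derive_continuous (fdf _ tab).
- move=> /eqP; rewrite subr_eq => /eqP ->; rewrite lerDr mulr_ge0 ?subr_ge0 //.
  by apply: df0; move: cab; rewrite in_itv.
Qed.

(** The integral is taken from a fixed left end [- L], which cannot serve all [x]. Subtracting the
    value at 0 makes the result independent of [L], so [L] may vary with [x]. *)
Lemma antiderivative_exists f : continuous f ->
  exists F, F 0 = 0 /\ forall x : R, is_derive x 1 F (f x).
Proof.
move=> cf.
pose G L x : R := (\int[@lebesgue_measure R]_(t in `[- L, x]) f t)%R.
have dG (L x : R) : - L < x -> is_derive x 1 (G L) (f x).
  move=> Lx; have x1 : x < x + 1 by lra.
  have [|||dG1 dG2] := @continuous_FTC1_closed R f (- L) x (x + 1) x1.
  - apply: continuous_compact_integrable; first exact: segment_compact.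
    exact: continuous_subspaceT.
  - by [].
  - exact: cf.
  - by rewrite -dG2 derive1E; apply: DeriveDef.
have GE (L L' x : R) : - L < x -> - L < 0 -> L <= L' -> G L x - G L 0 = G L' x - G L' 0.
  move=> Lx L0 LL'.
  have dD (t : R) : - L < t -> is_derive t 1 (G L' - G L) 0.
    move=> Lt; rewrite -[X in is_derive _ _ _ X](subrr (f t)).
    by apply: is_deriveB; apply: dG => //; lra.
  suff : (G L' - G L) x = (G L' - G L) 0 by rewrite !fctE; lra.
  have le01 (a b : R) : - L < a -> a <= b -> (G L' - G L) a = (G L' - G L) b.
    move=> La ab; apply/eqP; rewrite eq_le; apply/andP; split.
      apply: (@derive_ge0_le _ (fun=> 0)) => // t /andP[at_ _].
      by apply: dD; lra.
    rewrite -lerN2; apply: (@derive_ge0_le (- (G L' - G L)) (fun=> 0)) => // t /andP[at_ _].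
    by rewrite -oppr0; apply: is_deriveN; apply: dD; lra.
  by case: (leP x 0) => x0; [|apply/esym]; apply: le01 => //; exact: ltW.
exists (fun x => G (`|x| + 1) x - G (`|x| + 1) 0); split; first by rewrite subrr.
(* One [L] for all [t] at distance less than 1 from [x], since then [|t| + 1] is at most
   [|x| + 2]. *)
move=> x; set L := `|x| + 2.
have := ler_norm x; have := ler_norm (- x); rewrite normrN => h1 h2.
apply: (@near_eq_is_derive _ _ _ (fun t => G L t - G L 0)).
- near=> t.
  have : `|x - t| < 1 by near: t; apply: nbhsx_ballx.
  rewrite ltr_norml => /andP[h3 h4].
  have h5 := ler_normD x (t - x).
  rewrite addrCA subrr addr0 in h5.
  have h6 : `|t - x| < 1 by rewrite ltr_norml; lra.
  have := ler_norm t; have := ler_norm (- t); rewrite normrN => h7 h8.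
  by apply/esym/GE; rewrite /L; lra.
- rewrite -[f x]subr0; apply: is_deriveB; apply: dG; rewrite /L; lra.
Unshelve. all: by end_near.
Qed.

Lemma is_derive_compN f (x d : R) :
  is_derive (- x) 1 f d -> is_derive x 1 (fun t => f (- t)) (- d).
Proof.
move=> fd; have := @is_derive1_comp R f -%R x _ _ fd (is_deriveN (is_derive_id x 1)).
by rewrite mulrN1.
Qed.

(** Against the weight [expR (c * |t|)], integration from 0 divides a bound by [c]; taking [c] twice
    the size of the coefficients gives a contraction. Negative [x] is treated by reflection. *)
Lemma derive_expR_bound f df (B c L x : R) : 0 <= c -> 0 <= B ->
  f 0 = 0 -> (forall t : R, is_derive t 1 f (df t)) ->
  (forall t, `|t| <= L -> `|df t| <= c * B * expR (c * `|t|)) ->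
  `|x| <= L -> `|f x| <= B * expR (c * `|x|).
Proof.
move=> c0 B0.
have half (g dg : R -> R) (s : R) : 0 <= s -> g 0 = 0 ->
    (forall t : R, is_derive t 1 g (dg t)) ->
    (forall t, `|t| <= s -> `|dg t| <= c * B * expR (c * `|t|)) ->
    g s <= B * expR (c * s).
  move=> s0 g0 gdg dgle.
  have dE (t : R) : is_derive t 1 (fun u => B * expR (c * u) - g u)
      (B * (c * expR (c * t)) - dg t).
    apply: is_deriveB; apply: is_deriveZ => /=.
    have := @is_derive1_comp R expR ( *%R c) t _ _ (is_derive_expR _)
      (is_deriveZ c (is_derive_id t 1)).
    by rewrite [X in is_derive _ _ _ X -> _]mulrC [c *: 1]mulr1.
  have : B * expR (c * 0) - g 0 <= B * expR (c * s) - g s.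
    apply: (derive_ge0_le s0 (fun t _ => dE t)) => t /andP[t0 ts].
    by have := dgle t; rewrite ger0_norm // => /(_ ts); rewrite ler_norml; lra.
  by rewrite g0 mulr0 expR0; lra.
have half2 (g dg : R -> R) (s : R) : 0 <= s -> g 0 = 0 ->
    (forall t : R, is_derive t 1 g (dg t)) ->
    (forall t, `|t| <= s -> `|dg t| <= c * B * expR (c * `|t|)) ->
    `|g s| <= B * expR (c * s).
  move=> s0 g0 gdg dgle; rewrite ler_norml lerNl; apply/andP; split; last exact: half.
  apply: (half (- g) (- dg)) => // [|t ts].
  - by rewrite fctE g0 oppr0.
  - by rewrite fctE normrN; apply: dgle.
move=> f0 fdf dfle xL; case: (leP 0 x) => x0.
  rewrite [in leRHS]ger0_norm //; apply: (half2 f df) => // t tx.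
  by apply/dfle/(le_trans tx); rewrite -(ger0_norm x0).
rewrite -{1}(opprK x) [in leRHS]ltr0_norm //.
apply: (half2 (fun t => f (- t)) (fun t => - df (- t))).
- by lra.
- by rewrite oppr0.
- by move=> t; apply: is_derive_compN.
- move=> t tx; rewrite normrN -[`|t|]normrN; apply/dfle.
  by rewrite normrN (le_trans tx) // -(ltr0_norm x0).
Qed.

Lemma geometric_lt (A e : R) : 0 < e -> exists m, A / 2 ^+ m < e.
Proof.
move=> e0; exists (Num.truncn (A / e)).+1.
rewrite ltr_pdivrMr ?exprn_gt0 // -ltr_pdivrMl // mulrC.
rewrite (lt_le_trans (truncnS_gt _)) //.
by rewrite -natrX ler_nat ltnW // ltn_expl.
Qed.

Lemma geometric_bound0 (A d : R) : (forall m, `|d| <= A / 2 ^+ m) -> d = 0.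
Proof.
move=> dA; apply/eqP; rewrite -normr_le0.
apply/ler_addgt0Pl => e e0; rewrite addr0.
by have [m /ltW] := geometric_lt A e0; apply: le_trans.
Qed.

(** The intervals of radius $2A/2^m$ around [u m] are nested, so the supremum of their left ends
    lies in all of them. *)
Lemma geometric_cvg (u : nat -> R) (A : R) :
  (forall m, `|u m.+1 - u m| <= A / 2 ^+ m) ->
  exists l, forall m, `|u m - l| <= 2 * A / 2 ^+ m.
Proof.
move=> uA; pose r m := 2 * A / 2 ^+ m.
have rS m : r m.+1 = r m / 2 by rewrite /r exprS; field; rewrite expf_neq0.
have A0 : 0 <= A by have := uA 0; rewrite expr0 divr1; apply: le_trans.
have r0 m : 0 <= r m by rewrite divr_ge0 ?exprn_ge0 ?mulr_ge0.
have uA' m : `|u m.+1 - u m| <= r m / 2.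
  by rewrite (le_trans (uA m)) // /r mulrAC [2 * A]mulrC mulfK.
have lo : {homo (fun m => u m - r m) : m k / (m <= k)%N >-> m <= k}.
  apply: homo_leq => [//|x y z|m]; first exact: le_trans.
  by have := uA' m; rewrite rS ler_norml; lra.
have hi : {homo (fun m => u m + r m) : m k / (m <= k)%N >-> k <= m}.
  apply: (@homo_leq _ _ (fun x y => y <= x)) => [//|x y z|m].
    by move=> h1 h2; apply: le_trans h2 h1.
  by have := uA' m; rewrite rS ler_norml; lra.
pose E := range (fun m => u m - r m).
have ubE m : ubound E (u m + r m).
  move=> _ [k _ <-].
  apply: (@le_trans _ _ (u (maxn m k) - r (maxn m k))).
    exact: lo (leq_maxr _ _).
  apply: (@le_trans _ _ (u (maxn m k) + r (maxn m k))).
    by have := r0 (maxn m k); lra.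
  exact: hi (leq_maxl _ _).
have supE : has_sup E.
  by split; [exists (u 0 - r 0); exists 0|exists (u 0 + r 0); exact: ubE].
exists (sup E) => m; rewrite ler_norml.
have h1 : u m - r m <= sup E by apply: ub_le_sup; [exact: supE.2|exists m].
have h2 : sup E <= u m + r m by apply: ge_sup; [exact: supE.1|exact: ubE].
by rewrite -/(r m); lra.
Qed.

Lemma continuous_bounded_on_ball f (L : R) : continuous f ->
  exists2 K, 0 < K & forall t, `|t| <= L -> `|f t| <= K.
Proof.
move=> cf; have /compact_bounded [M [_ MB]] : compact (f @` `[- L, L]).
  by apply: continuous_compact; [exact: continuous_subspaceT|exact: segment_compact].
exists (`|M| + 1); first by rewrite ltr_wpDl.
move=> t tL; apply: (MB (`|M| + 1)); first by have := ler_norm M; lra.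
by exists t => //; rewrite /= in_itv /= -ler_norml.
Qed.

Lemma geometric_limit_continuous (s : nat -> R -> R) f (x : R) :
  (forall m, {for x, continuous (s m)}) ->
  (exists A : R, forall m t, `|t - x| <= 1 -> `|s m t - f t| <= A / 2 ^+ m) ->
  {for x, continuous f}.
Proof.
move=> cs [A sA]; apply/cvgrPdist_lt => e e0.
have e3 : 0 < e / 3 by lra.
have [m Am] := geometric_lt A e3.
have /cvgrPdist_lt/(_ _ e3) csm := cs m.
near=> t.
have tx : `|t - x| <= 1.
  by rewrite distrC ltW //; near: t; apply: nbhsx_ballx.
have := sA m t tx; have := sA m x; rewrite subrr normr0 => /(_ ler01).
have : `|s m x - s m t| < e / 3 by near: t.
rewrite !ler_norml !ltr_norml; lra.
Unshelve. all: by end_near.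
Qed.

Lemma is_derive_sum_fun (I : finType) (g dg : I -> R -> R) (x : R) :
  (forall i, is_derive x 1 (g i) (dg i x)) ->
  is_derive x 1 (fun t => \sum_i g i t) (\sum_i dg i x).
Proof.
move=> gdg; rewrite (_ : (fun t => _) = \sum_i g i); last first.
  by apply/funext => t; rewrite fct_sumE.
elim/big_ind2 : _ => [|f1 d1 f2 d2 h1 h2|i _]; last exact: gdg.
  exact: is_derive_cst.
exact: is_deriveD.
Qed.

Lemma continuous_sum_fun (I : finType) (g : I -> R -> R) :
  (forall i, continuous (g i)) -> continuous (fun t => \sum_i g i t).
Proof.
move=> cg; rewrite (_ : (fun t => _) = \sum_i g i); last first.
  by apply/funext => t; rewrite fct_sumE.
elim/big_ind : _ => [|f1 f2 h1 h2|i _]; last exact: cg.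
  by move=> t; apply: cvg_cst.
by move=> t; apply: continuousD; [exact: h1|exact: h2].
Qed.

(* Picard iteration. The weights [expR (2 * K * |x|)] make each iteration halve
   the distance on every interval where the coefficients are bounded by [K], so
   no smallness of the interval is needed. *)
Lemma linear_ode_exists (I : finType) (M : I -> I -> R -> R) (y0 : I -> R) :
  (forall i j, continuous (M i j)) ->
  exists y : I -> R -> R, (forall i, y i 0 = y0 i) /\
    forall i (x : R), is_derive x 1 (y i) (\sum_j M i j x * y j x).
Proof.
move=> cM.
(* A total antiderivative operator, with default value 0 on discontinuous arguments; the iteration
   applies it only to continuous ones. *)
have /choice[P PE] (f : R -> R) : exists F, continuous f ->
    F 0 = 0 /\ forall x : R, is_derive x 1 F (f x).
  have [/antiderivative_exists[F FE]|nf] := pselect (continuous f).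
    by exists F.
  by exists (fun=> 0) => /nf.
have cMy (y : I -> R -> R) i : (forall j, continuous (y j)) ->
    continuous (fun x => \sum_j M i j x * y j x).
  move=> cy; apply: continuous_sum_fun => j x.
  by apply: continuousM; [exact: cM|exact: cy].
pose step (y : I -> R -> R) i x := y0 i + P (fun t => \sum_j M i j t * y j t) x.
have step0 y i : (forall j, continuous (y j)) -> step y i 0 = y0 i.
  by move=> cy; rewrite /step (PE _ (cMy _ i cy)).1 addr0.
have stepD y i (x : R) : (forall j, continuous (y j)) ->
    is_derive x 1 (step y i) (\sum_j M i j x * y j x).
  move=> cy; rewrite -[\sum_j _]add0r; apply: is_deriveD.
  exact: (PE _ (cMy _ i cy)).2.
have stepC y i : (forall j, continuous (y j)) -> continuous (step y i).
  by move=> cy x; apply: is_derive_continuous (stepD _ _ _ cy).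
have bound L : exists2 K, 0 < K & forall y z A, 0 <= A ->
    (forall j, continuous (y j)) -> (forall j, continuous (z j)) ->
    (forall j t, `|t| <= L -> `|y j t - z j t| <= A * expR (2 * K * `|t|)) ->
    forall i t, `|t| <= L ->
      `|step y i t - step z i t| <= A / 2 * expR (2 * K * `|t|).
  have /choice[k kP] : forall ij : I * I, exists k, 0 < k /\
      forall t, `|t| <= L -> `|M ij.1 ij.2 t| <= k.
    by move=> [i j]; have [k k0 kP] := continuous_bounded_on_ball L (cM i j); exists k.
  (* [K] dominates every row sum of the coefficients, and the added 1 keeps it positive. *)
  pose K := 1 + \sum_i \sum_j k (i, j).
  have K0 : 0 < K.
    rewrite ltr_pwDl // sumr_ge0 // => i _; rewrite sumr_ge0 // => j _.
    exact: ltW (kP (i, j)).1.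
  exists K => // y z A A0 cy cz yz i t tL.
  pose d x := \sum_j M i j x * y j x - \sum_j M i j x * z j x.
  apply: (@derive_expR_bound (fun x => step y i x - step z i x) d _ _ L) => //.
  - by rewrite mulr_ge0 // ltW.
  - by rewrite divr_ge0.
  - by rewrite !step0 // subrr.
  - by move=> x; apply: is_deriveB; apply: stepD.
  move=> x xL; rewrite /d -sumrB.
  rewrite (_ : 2 * K * (A / 2) = K * A); last by field.
  rewrite (le_trans (ler_norm_sum _ _ _)) //.
  apply: (@le_trans _ _ (\sum_j k (i, j) * (A * expR (2 * K * `|x|)))).
    apply: ler_sum => j _; rewrite -mulrBr normrM ler_pM //.
      exact: (kP (i, j)).2.
    exact: yz.
  rewrite -mulr_suml -[leRHS]mulrA ler_wpM2r ?mulr_ge0 ?expR_ge0 //.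
  rewrite /K [in leRHS](bigD1 i) //= addrCA lerDl addr_ge0 // sumr_ge0 // => l _.
  by rewrite sumr_ge0 // => j _; apply: ltW (kP (l, j)).1.
pose s m := iter m step (fun i => cst (y0 i)).
have sC m j : continuous (s m j).
  elim: m j => [|m IHm] j; last exact: stepC.
  by move=> t; apply: cvg_cst.
have sA L : exists A, forall m i t, `|t| <= L ->
    `|s m.+1 i t - s m i t| <= A / 2 ^+ m.
  have [K K0 KP] := bound L.
  have [B B0 BP] : exists2 B, 0 <= B & forall i t, `|t| <= L -> `|s 1 i t - s 0 i t| <= B.
    have /choice[B BP] i : exists B, 0 < B /\ forall t, `|t| <= L -> `|s 1 i t - s 0 i t| <= B.
      have cd : continuous (fun t => s 1 i t - s 0 i t).
        by move=> t; apply: continuousB; apply: sC.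
      by have [B B0 BP] := continuous_bounded_on_ball L cd; exists B.
    exists (\sum_i B i); first by rewrite sumr_ge0 // => i _; apply: ltW (BP i).1.
    move=> i t tL; rewrite (le_trans ((BP i).2 t tL)) // (bigD1 i) //= lerDl.
    by rewrite sumr_ge0 // => j _; apply: ltW (BP j).1.
  have sB m : forall i t, `|t| <= L ->
      `|s m.+1 i t - s m i t| <= B / 2 ^+ m * expR (2 * K * `|t|).
    elim: m => [|m IHm] i t tL.
      rewrite expr0 divr1 (le_trans (BP i t tL)) // ler_peMr //.
      by rewrite -expR0 ler_expR !mulr_ge0 // ltW.
    rewrite exprS invfM mulrCA mulrC mulrA.
    rewrite (_ : expR _ * _ = B / 2 ^+ m / 2 * expR (2 * K * `|t|)); last by ring.
    by apply: KP => //; [rewrite divr_ge0 ?exprn_ge0 // | exact: (sC m.+1)].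
  exists (B * expR (2 * K * L)) => m i t tL.
  rewrite (le_trans (sB m i t tL)) // [leRHS]mulrAC.
  by rewrite ler_wpM2l ?divr_ge0 ?exprn_ge0 // ler_expR ler_wpM2l // mulr_ge0 // ltW.
(* The limit is chosen separately at each point. Uniqueness of limits ([yU]) then transfers to it
   the rates valid on whole intervals. *)
have /choice[z zP] (ix : I * R) : exists l, exists A, forall m,
    `|s m ix.1 ix.2 - l| <= A / 2 ^+ m.
  case: ix => i x; have [A AP] := sA `|x|.
  have [l lP] := @geometric_cvg (fun m => s m i x) A (fun m => AP m i x (lexx _)).
  by exists l, (2 * A).
pose y i x := z (i, x).
have yP i x : exists A, forall m, `|s m i x - y i x| <= A / 2 ^+ m := zP (i, x).
have yU i x l A : (forall m, `|s m i x - l| <= A / 2 ^+ m) -> y i x = l.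
  move=> lA; have [A' yA] := yP i x; apply/eqP; rewrite -subr_eq0; apply/eqP.
  apply: (@geometric_bound0 (A + A')) => m.
  rewrite mulrDl (le_trans _ (lerD (lA m) (yA m))) //.
  by rewrite (_ : y i x - l = (s m i x - l) - (s m i x - y i x)); [exact: ler_normB|ring].
have yA L : exists2 A, 0 <= A & forall m i t, `|t| <= L -> `|s m i t - y i t| <= A / 2 ^+ m.
  have [A AP] := sA L; exists (2 * `|A|); first by rewrite mulr_ge0.
  move=> m i t tL.
  have [l lP] := @geometric_cvg (fun m => s m i t) A (fun m => AP m i t tL).
  rewrite (yU _ _ _ _ lP) (le_trans (lP m)) //.
  by rewrite ler_wpM2r ?invr_ge0 ?exprn_ge0 // ler_wpM2l // ler_norm.
have cy i : continuous (y i).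
  move=> x; apply: (@geometric_limit_continuous (fun m => s m i)) => [m|]; first exact: sC.
  have [A _ AP] := yA (`|x| + 1); exists A => m t tx; apply: AP.
  by rewrite -(subrK x t) (le_trans (ler_normD _ _)) // addrC lerD2l.
(* Both [y] and [step y] are limits of the same iterates [s m.+1]. *)
have yE i x : y i x = step y i x.
  have [K K0 KP] := bound `|x|; have [A A0 AP] := yA `|x|.
  have sS m : `|s m.+1 i x - step y i x| <= A * expR (2 * K * `|x|) / 2 / 2 ^+ m.
    have := KP (s m) y (A / 2 ^+ m) _ (sC m) cy _ i x (lexx _).
    rewrite (_ : A / 2 ^+ m / 2 * expR (2 * K * `|x|) =
      A * expR (2 * K * `|x|) / 2 / 2 ^+ m); last by ring.
    apply => [|j t tx]; first by rewrite divr_ge0 ?exprn_ge0.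
    rewrite (le_trans (AP m j t tx)) // ler_peMr ?divr_ge0 ?exprn_ge0 //.
    by rewrite -expR0 ler_expR !mulr_ge0 // ltW.
  apply/eqP; rewrite -subr_eq0; apply/eqP.
  apply: (@geometric_bound0 (A * expR (2 * K * `|x|) / 2 + A)) => m.
  have h1 := sS m; have h2 := AP m.+1 i x (lexx _).
  have h3 : A / 2 ^+ m.+1 <= A / 2 ^+ m.
    by rewrite ler_wpM2l // lef_pV2 ?posrE ?exprn_gt0 // exprS ler_peMl ?exprn_ge0 // ler1n.
  rewrite mulrDl (le_trans _ (lerD h1 (le_trans h2 h3))) //.
  rewrite (_ : y i x - _ = s m.+1 i x - step y i x - (s m.+1 i x - y i x)); last ring.
  exact: ler_normB.
exists y; split=> [i|i x]; first by rewrite yE step0.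
by rewrite (_ : y i = step y i) ?funeqE //; apply: stepD.
Qed.

End LinearODE.

(** * Calculus of Clifford-valued curves *)

Section Scalars.
Variables (R : realType) (K : scalar_kind).
Local Notation F := (scalars R K).
Implicit Types (z w : F) (f g : R -> F) (x : R).

(** Over the reals the second argument is discarded, so the imaginary part of the result is then 0
    and not [b]. Later statements therefore keep the composite [im_part (mk_scalar a b)]. *)
Definition mk_scalar : R -> R -> F :=
  match K with
  | RealScalars => fun a _ => a
  | ComplexScalars => fun a b => a +i* b
  end%C.

Lemma re_partD z w : re_part (z + w) = re_part z + re_part w.
Proof. by move: z w; rewrite /re_part; case: K => [] //= [a b] [c d]. Qed.

Lemma im_partD z w : im_part (z + w) = im_part z + im_part w.
Proof.
by move: z w; rewrite /im_part; case: K => //= [z w|[a b] [c d] //]; rewrite addr0.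
Qed.

Lemma re_partM z w : re_part (z * w) = re_part z * re_part w - im_part z * im_part w.
Proof.
move: z w; rewrite /re_part /im_part; case: K => //= [z w|[a b] [c d] //].
by rewrite mulr0 subr0.
Qed.

Lemma im_partM z w : im_part (z * w) = re_part z * im_part w + im_part z * re_part w.
Proof.
move: z w; rewrite /re_part /im_part; case: K => //= [z w|[a b] [c d] //].
by rewrite mulr0 mul0r addr0.
Qed.

Lemma re_part0 : re_part (0 : F) = 0.
Proof. by rewrite /re_part; case: K. Qed.

Lemma im_part0 : im_part (0 : F) = 0.
Proof. by rewrite /im_part; case: K. Qed.

Lemma scalar_eq z w : re_part z = re_part w -> im_part z = im_part w -> z = w.
Proof.
by move: z w; rewrite /re_part /im_part; case: K => //= -[a b] [c d] /= -> ->.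
Qed.

Lemma re_part_sum (I : finType) (c : I -> F) :
  re_part (\sum_i c i) = \sum_i re_part (c i).
Proof. by apply: big_morph; [exact: re_partD|exact: re_part0]. Qed.

Lemma im_part_sum (I : finType) (c : I -> F) :
  im_part (\sum_i c i) = \sum_i im_part (c i).
Proof. by apply: big_morph; [exact: im_partD|exact: im_part0]. Qed.

Lemma re_mk_scalar a b : re_part (mk_scalar a b) = a.
Proof. by rewrite /re_part /mk_scalar; case: K. Qed.

Lemma im_mk_scalar0 a : im_part (mk_scalar a 0) = 0.
Proof. by rewrite /im_part /mk_scalar; case: K. Qed.

Lemma mk_scalarK z : mk_scalar (re_part z) (im_part z) = z.
Proof. by move: z; rewrite /mk_scalar /re_part /im_part; case: K => //= -[]. Qed.

Lemma mk_scalar_decomp a b :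
  mk_scalar a b = mk_scalar a 0 + mk_scalar b 0 * mk_scalar 0 1.
Proof.
rewrite /mk_scalar; case: K => /=; first by rewrite mulr0 addr0.
by apply/eqP; rewrite eq_complex /= !(mulr0, mulr1, mul0r, subr0, addr0, add0r) !eqxx.
Qed.

Lemma is_derive_mk_scalar (a b : R -> R) x da db :
  is_derive x 1 a da -> is_derive x 1 b db ->
  is_derive x 1 (fun t => im_part (mk_scalar (a t) (b t))) (im_part (mk_scalar da db)).
Proof.
by rewrite /mk_scalar /im_part; case: K => //= _ _; apply: is_derive_cst.
Qed.

Lemma continuous_mk_scalar (a b : R -> R) : continuous b ->
  continuous (fun t => im_part (mk_scalar (a t) (b t))).
Proof.
rewrite /mk_scalar /im_part; case: K => //= _ t; exact: cvg_cst.
Qed.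

Definition scalar_derive f x z :=
  is_derive x 1 (fun t => re_part (f t)) (re_part z) /\
  is_derive x 1 (fun t => im_part (f t)) (im_part z).

Lemma scalar_derive_cst z x : scalar_derive (fun=> z) x 0.
Proof. by split; rewrite ?re_part0 ?im_part0; apply: is_derive_cst. Qed.

Lemma scalar_deriveM f g x z w : scalar_derive f x z -> scalar_derive g x w ->
  scalar_derive (fun t => f t * g t) x (z * g x + f x * w).
Proof.
move=> [rf mf] [rg mg]; split.
  rewrite (_ : (fun t => _) = (fun t => re_part (f t)) * (fun t => re_part (g t))
      - (fun t => im_part (f t)) * (fun t => im_part (g t))); last first.
    by apply/funext => t; rewrite re_partM.
  move: (is_deriveB (is_deriveM rf rg) (is_deriveM mf mg)); congr (is_derive _ _ _ _).
  by rewrite re_partD !re_partM /GRing.scale /=; ring.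
rewrite (_ : (fun t => _) = (fun t => re_part (f t)) * (fun t => im_part (g t))
    + (fun t => im_part (f t)) * (fun t => re_part (g t))); last first.
  by apply/funext => t; rewrite im_partM.
move: (is_deriveD (is_deriveM rf mg) (is_deriveM mf rg)); congr (is_derive _ _ _ _).
by rewrite im_partD !im_partM /GRing.scale /=; ring.
Qed.

Lemma scalar_derive_sum (I : finType) (f : I -> R -> F) x (z : I -> F) :
  (forall i, scalar_derive (f i) x (z i)) ->
  scalar_derive (fun t => \sum_i f i t) x (\sum_i z i).
Proof.
move=> fz; split.
  rewrite re_part_sum (_ : (fun t => _) = fun t => \sum_i re_part (f i t)); last first.
    by apply/funext => t; rewrite re_part_sum.
  by apply: (is_derive_sum_fun (dg := fun i _ => re_part (z i))) => i; have [] := fz i.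
rewrite im_part_sum (_ : (fun t => _) = fun t => \sum_i im_part (f i t)); last first.
  by apply/funext => t; rewrite im_part_sum.
by apply: (is_derive_sum_fun (dg := fun i _ => im_part (z i))) => i; have [] := fz i.
Qed.

Definition scalar_continuous f :=
  continuous (fun t => re_part (f t)) /\ continuous (fun t => im_part (f t)).

Lemma scalar_continuous_cst z : scalar_continuous (fun=> z).
Proof. by split=> t; apply: cvg_cst. Qed.

Lemma scalar_continuousM f g : scalar_continuous f -> scalar_continuous g ->
  scalar_continuous (fun t => f t * g t).
Proof.
move=> [rf mf] [rg mg]; split.
  rewrite (_ : (fun t => _) = fun t => re_part (f t) * re_part (g t)
      - im_part (f t) * im_part (g t)) => [t|]; last first.
    by apply/funext => t; rewrite re_partM.
  exact: (continuousB (continuousM (rf t) (rg t)) (continuousM (mf t) (mg t))).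
rewrite (_ : (fun t => _) = fun t => re_part (f t) * im_part (g t)
    + im_part (f t) * re_part (g t)) => [t|]; last first.
  by apply/funext => t; rewrite im_partM.
exact: (continuousD (continuousM (rf t) (mg t)) (continuousM (mf t) (rg t))).
Qed.

Lemma scalar_continuous_sum (I : finType) (f : I -> R -> F) :
  (forall i, scalar_continuous (f i)) ->
  scalar_continuous (fun t => \sum_i f i t).
Proof.
move=> cf; split.
  rewrite (_ : (fun t => _) = fun t => \sum_i re_part (f i t)).
    by apply: continuous_sum_fun => i; have [] := cf i.
  by apply/funext => t; rewrite re_part_sum.
rewrite (_ : (fun t => _) = fun t => \sum_i im_part (f i t)).
  by apply: continuous_sum_fun => i; have [] := cf i.
by apply/funext => t; rewrite im_part_sum.
Qed.

End Scalars.

Section Curves.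
Variables (R : realType) (K : scalar_kind) (p q : nat).
Local Notation n := (p + q)%N.
Local Notation F := (scalars R K).
Local Notation Cl := (clifford F p q).
Implicit Types (f g : R -> Cl) (U V W : Cl) (x : R) (A B : {set 'I_n}).

Lemma has_derivative_unique f x U V :
  has_derivative f x U -> has_derivative f x V -> U = V.
Proof.
move=> fU fV; apply/ffunP => A; have [rU mU] := fU A; have [rV mV] := fV A.
apply: scalar_eq.
  by rewrite -(@derive_val _ _ _ _ _ _ _ rU) (@derive_val _ _ _ _ _ _ _ rV).
by rewrite -(@derive_val _ _ _ _ _ _ _ mU) (@derive_val _ _ _ _ _ _ _ mV).
Qed.

Lemma has_derivative0_cst f : (forall x, has_derivative f x 0) ->
  forall x y, f x = f y.
Proof.
move=> f0 x y; apply/ffunP => A; apply: scalar_eq.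
  apply: (@is_derive_0_is_cst _ (re_coord f A)) => t.
  by have [+ _] := f0 t A; rewrite ffunE re_part0.
apply: (@is_derive_0_is_cst _ (im_coord f A)) => t.
by have [_] := f0 t A; rewrite ffunE im_part0.
Qed.

Lemma has_derivative_cst U x : has_derivative (fun=> U) x 0.
Proof. by move=> A; rewrite ffunE; apply: scalar_derive_cst. Qed.

Lemma has_derivativeM f g x U V : has_derivative f x U -> has_derivative g x V ->
  has_derivative (fun t => f t * g t) x (U * g x + f x * V).
Proof.
move=> fU gV C.
suff : scalar_derive (fun t => (f t * g t) C) x ((U * g x + f x * V) C) by [].
(* The summand with factor 0 is the derivative of the constant [blade_sign], kept to match the shape
   given by [scalar_deriveM]. *)
have -> : (U * g x + f x * V) C = \sum_A (0 * (f x A * g x (symdiff A C)) +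
    blade_sign F A (symdiff A C) *
      (U A * g x (symdiff A C) + f x A * V (symdiff A C))).
  rewrite !ffunE -big_split; apply: eq_bigr => A _ /=.
  by rewrite mul0r add0r mulrDr.
rewrite (_ : (fun t => _) = fun t => \sum_A blade_sign F A (symdiff A C) *
    (f t A * g t (symdiff A C))); last by apply/funext => t; rewrite ffunE.
apply: scalar_derive_sum => A; apply: scalar_deriveM; first exact: scalar_derive_cst.
by apply: scalar_deriveM; [exact: fU|exact: gV].
Qed.

Lemma has_derivativeZ (k : F) f x U : has_derivative f x U ->
  has_derivative (fun t => k *: f t) x (k *: U).
Proof.
move=> fU; have := has_derivativeM (has_derivative_cst k%:A x) fU.
rewrite mul0r add0r -scalerAl mul1r.
by rewrite (_ : (fun t => _) = fun t => k *: f t) //; apply/funext => t;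
  rewrite -scalerAl mul1r.
Qed.

Definition curve_continuous f := forall A, scalar_continuous (f^~ A).

Lemma curve_continuous_cst U : curve_continuous (fun=> U).
Proof. by move=> A; apply: scalar_continuous_cst. Qed.

Lemma curve_continuousM f g : curve_continuous f -> curve_continuous g ->
  curve_continuous (fun t => f t * g t).
Proof.
move=> cf cg C.
rewrite (_ : (fun t => _) = fun t => \sum_A blade_sign F A (symdiff A C) *
    (f t A * g t (symdiff A C))); last by apply/funext => t; rewrite ffunE.
apply: scalar_continuous_sum => A; apply: scalar_continuousM.
  exact: scalar_continuous_cst.
by apply: scalar_continuousM; [exact: cf|exact: cg].
Qed.

Lemma curve_continuous_sum (I : finType) (f : I -> R -> Cl) :
  (forall i, curve_continuous (f i)) -> curve_continuous (fun t => \sum_i f i t).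
Proof.
move=> cf A; rewrite (_ : (fun t => _) = fun t => \sum_i f i t A); last first.
  by apply/funext => t; rewrite sum_ffunE.
by apply: scalar_continuous_sum => i; apply: cf.
Qed.

Lemma curve_continuousD f g : curve_continuous f -> curve_continuous g ->
  curve_continuous (fun t => f t + g t).
Proof.
move=> cf cg; have := @curve_continuous_sum bool (fun b => if b then f else g).
rewrite (_ : (fun t => \sum_b _) = fun t => f t + g t); first by apply; case.
by apply/funext => t; rewrite big_bool.
Qed.

Lemma curve_continuousZ (k : F) f : curve_continuous f ->
  curve_continuous (fun t => k *: f t).
Proof.
move=> cf; have := curve_continuousM (curve_continuous_cst k%:A) cf.
by rewrite (_ : (fun t => _) = fun t => k *: f t) //; apply/funext => t;
  rewrite -scalerAl mul1r.
Qed.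

Lemma has_derivative_continuous f : (forall x, exists U, has_derivative f x U) ->
  curve_continuous f.
Proof.
move=> fD A; split=> t; have [U fU] := fD t; have [rU mU] := fU A.
  exact: is_derive_continuous rU.
exact: is_derive_continuous mU.
Qed.

Definition continuously_differentiable f := exists2 df : R -> Cl,
  forall x, has_derivative f x (df x) & curve_continuous df.

Lemma smooth_continuously_differentiable f : smooth f ->
  continuously_differentiable f.
Proof.
move=> fS; pose df x : Cl :=
  [ffun A => mk_scalar K (derive1 (re_coord f A) x) (derive1 (im_coord f A) x)].
have smooth0 (u : R -> R) x : smooth_fun u -> is_derive x 1 u (derive1 u x).
  by move=> /(_ 0%N x) uD; rewrite derive1E; apply/derivableP.
have smooth1 (u : R -> R) : smooth_fun u -> continuous (derive1 u).
  by move=> /(_ 1%N) uD x; apply: differentiable_continuous; apply/derivable1_diffP/uD.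
exists df => [x A|A]; have [rA mA] := fS A; rewrite ?ffunE.
  split; first by rewrite re_mk_scalar; apply: smooth0.
  have := is_derive_mk_scalar K (smooth0 _ x rA) (smooth0 _ x mA).
  by congr (is_derive _ _ _ _); apply/funext => t; rewrite mk_scalarK.
split.
  rewrite (_ : (fun t => _) = derive1 (re_coord f A)); first exact: smooth1.
  by apply/funext => t; rewrite ffunE re_mk_scalar.
rewrite (_ : (fun t => _) = fun t => im_part (mk_scalar K
    (derive1 (re_coord f A) t) (derive1 (im_coord f A) t))).
  by apply: continuous_mk_scalar; apply: smooth1.
by apply/funext => t; rewrite ffunE.
Qed.

Lemma continuously_differentiable_prod (I : Type) (s : seq I) (P : pred I)
    (f : I -> R -> Cl) : (forall i, continuously_differentiable (f i)) ->
  continuously_differentiable (fun x => \prod_(i <- s | P i) f i x).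
Proof.
move=> fD; elim: s => [|i s [ds dsP cds]].
  exists (fun=> 0); last exact: curve_continuous_cst.
  move=> x; rewrite (_ : (fun t => _) = fun=> 1); first exact: has_derivative_cst.
  by apply/funext => t; rewrite big_nil.
case: (boolP (P i)) => Pi; last first.
  exists ds => // x; rewrite (_ : (fun t => _) = fun t => \prod_(j <- s | P j) f j t) //.
  by apply/funext => t; rewrite big_cons (negPf Pi).
have [di diP cdi] := fD i.
exists (fun t => di t * (\prod_(j <- s | P j) f j t) + f i t * ds t) => [x|].
  rewrite (_ : (fun t => _) = fun t => f i t * \prod_(j <- s | P j) f j t).
    exact: has_derivativeM.
  by apply/funext => t; rewrite big_cons Pi.
apply: curve_continuousD; apply: curve_continuousM => //.
  by apply: has_derivative_continuous => x; exists (ds x).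
by apply: has_derivative_continuous => x; exists (di x).
Qed.

(** An abstract linear [L] covers multiplication by the connection on either side. The unknowns are
    the real and imaginary parts of the coordinates, told apart by a boolean. *)
Lemma clifford_linear_ode (L : R -> Cl -> Cl) (U0 : Cl) :
  (forall x U V, L x (U + V) = L x U + L x V) ->
  (forall x k U, L x (k *: U) = k *: L x U) ->
  (forall U, curve_continuous (fun x => L x U)) ->
  exists S : R -> Cl, S 0 = U0 /\ forall x, has_derivative S x (L x (S x)).
Proof.
move=> LD LZ Lc; pose part (b : bool) (z : F) : R := if b then re_part z else im_part z.
(* In the complex case the second value is the imaginary unit; in the real case it is 0, and the
   corresponding coordinates stay zero. *)
pose i_unit (b : bool) : F := if b then 1 else mk_scalar K 0 1.
pose E (j : bool * {set 'I_n}) : Cl := i_unit j.1 *: blade F j.2.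
pose M (i j : bool * {set 'I_n}) x := part i.1 (L x (E j) i.2).
have [|y [y0 yD]] := @linear_ode_exists R _ M (fun i => part i.1 (U0 i.2)).
  by move=> [b A] j; rewrite /M /part /=; have [] := Lc (E j) A; case: b.
pose S x : Cl := [ffun A => mk_scalar K (y (true, A) x) (y (false, A) x)].
have SE x : S x = \sum_j mk_scalar K (y j x) 0 *: E j.
  transitivity (\sum_(b : bool) \sum_A mk_scalar K (y (b, A) x) 0 *: E (b, A)).
    rewrite [LHS]blade_sum big_bool -big_split; apply: eq_bigr => A _ /=.
    by rewrite /E /= ffunE !scalerA -scalerDl mulr1 -mk_scalar_decomp.
  by rewrite pair_bigA; apply: eq_bigr => -[].
have L0 x : L x 0 = 0 by have := LZ x 0 0; rewrite !scale0r.
have LS x A : L x (S x) A = \sum_j mk_scalar K (y j x) 0 * L x (E j) A.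
  rewrite SE (big_morph _ (LD x) (L0 x)) sum_ffunE; apply: eq_bigr => j _.
  by rewrite LZ ffunE.
have partLS b x A : part b (L x (S x) A) = \sum_j M (b, A) j x * y j x.
  rewrite LS /M /part /=; case: b; rewrite ?re_part_sum ?im_part_sum; apply: eq_bigr => j _.
    by rewrite re_partM re_mk_scalar im_mk_scalar0 mul0r subr0 mulrC.
  by rewrite im_partM re_mk_scalar im_mk_scalar0 mul0r addr0 mulrC.
exists S; split=> [|x A].
  by apply/ffunP => A; rewrite ffunE !y0 mk_scalarK.
split.
  rewrite (_ : re_coord S A = y (true, A)) -?[re_part _]/(part true _) ?partLS //.
  by apply/funext => t; rewrite /re_coord ffunE re_mk_scalar.
have := is_derive_mk_scalar K (yD (true, A) x) (yD (false, A) x).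
rewrite -!partLS mk_scalarK; congr (is_derive _ _ _ _).
by apply/funext => t; rewrite /im_coord ffunE.
Qed.

End Curves.

(** * Parallel transport *)

Section Transport.
Variables (R : realType) (K : scalar_kind) (p q : nat).
Local Notation n := (p + q)%N.
Local Notation F := (scalars R K).
Local Notation Cl := (clifford F p q).
Variable h : 'I_n -> R -> Cl.
Hypothesis h_rel : forall x, clifford_family (h^~ x).
Hypothesis h_odd : odd n -> forall x, Tr (volume (h^~ x)) = 0.

Lemma connection_blades (D : {set 'I_n} -> R -> Cl) A B x :
  (forall A x, has_derivative (fun t => blade_of (h^~ t) A) x (D A x)) ->
  D A x * blade_of (h^~ x) B + blade_of (h^~ x) A * D B x =
    blade_sign F A B *: D (symdiff A B) x.
Proof.
move=> DP; apply: has_derivative_unique (has_derivativeM (DP A x) (DP B x)) _.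
rewrite (_ : (fun t => _) = fun t =>
    blade_sign F A B *: blade_of (h^~ t) (symdiff A B)).
  exact: has_derivativeZ.
by apply/funext => t; rewrite blade_ofM.
Qed.

(** Continuity is carried along because the transport equation is solved for continuous
    coefficients. *)
Lemma connection_exists : (forall a, smooth (h a)) ->
  exists2 C, is_connection h C & curve_continuous C.
Proof.
move=> h_smooth.
have hD A : continuously_differentiable (fun x => blade_of (h^~ x) A).
  by apply: continuously_differentiable_prod => a; apply: smooth_continuously_differentiable.
have /choice[D DP] A : exists dA : R -> Cl,
    (forall x, has_derivative (fun t => blade_of (h^~ t) A) x (dA x)) /\
    curve_continuous dA.
  by have [dA] := hD A; exists dA.
have DD A x := (DP A).1 x.
have DM x A B := @connection_blades D A B x DD.
exists (fun x => connection_of (h^~ x) (D^~ x)).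
  split=> [x|a x]; first exact: (connection_of_noncentral (DM x)).
  exists (D [set a]%SET x).
    rewrite (_ : h a = fun t => blade_of (h^~ t) [set a]%SET) //.
    by apply/funext => t; rewrite blade_of1.
  by rewrite (connection_ofP (h_rel x) (DM x)) blade_of1 subrr.
apply: curve_continuousZ; apply: curve_continuous_sum => A.
apply: curve_continuousM; first exact: (DP A).2.
apply: curve_continuousZ; apply: has_derivative_continuous => x.
by exists (D A x).
Qed.

(** The difference commutes with every [h a x], hence is central, and it is also noncentral. *)
Lemma connection_unique C C' :
  is_connection h C -> is_connection h C' -> C =1 C'.
Proof.
move=> [CN CP] [CN' CP'] x; apply/eqP; rewrite -subr_eq0; apply/eqP.
apply: noncentral_central_eq0; last by rewrite rpredB.
apply: (family_commutant (h_rel x)) => [on|a]; first exact: h_odd.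
have [dh hD /eqP] := CP a x; have [dh' hD' /eqP] := CP' a x.
rewrite -(has_derivative_unique hD hD') !subr_eq0 => /eqP dhE' /eqP.
rewrite dhE' /bracket => E.
rewrite mulrBr mulrBl (canRL (subrK _) E).
by rewrite opprD opprB addrA [in RHS](addrC (C x * _)) subrK.
Qed.

(** The bracket with [C x] is a derivation, so it passes from the factors to their products. *)
Lemma connection_blade C A x : is_connection h C ->
  has_derivative (fun t => blade_of (h^~ t) A) x
    (bracket (C x) (blade_of (h^~ x) A)).
Proof.
move=> [_ CP]; rewrite /blade_of; elim: (index_enum _) => [|a s IHs].
  rewrite big_nil /bracket mulr1 mul1r subrr (_ : (fun t => _) = fun=> 1).
    exact: has_derivative_cst.
  by apply/funext => t; rewrite big_nil.
rewrite big_cons; case: ifPn => aA; last first.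
  rewrite (_ : (fun t => _) = fun t => \prod_(i <- s | i \in A) h i t) //.
  by apply/funext => t; rewrite big_cons (negPf aA).
rewrite (_ : (fun t => _) = fun t => h a t * \prod_(i <- s | i \in A) h i t); last first.
  by apply/funext => t; rewrite big_cons aA.
have [dh hD /eqP] := CP a x; rewrite subr_eq0 => /eqP dhE.
move: (has_derivativeM hD IHs); rewrite dhE /bracket; congr has_derivative.
by rewrite mulrBl mulrBr !mulrA addrA subrK.
Qed.

Lemma volume_ratio_cst C : is_connection h C -> odd n ->
  (forall x, volume_ratio h x = 1) \/ (forall x, volume_ratio h x = -1).
Proof.
move=> CP on; have volE x y : volume (h^~ x) = volume (h^~ y).
  rewrite !volume_blade.
  apply: (@has_derivative0_cst _ _ _ _ (fun t => blade_of (h^~ t) [set: 'I_n]%SET)) => t.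
  rewrite (_ : 0 = bracket (C t) (blade_of (h^~ t) finset.setT)).
    exact: connection_blade.
  rewrite /bracket -volume_blade; have [->|->] := volume_sign (h_rel t) on (h_odd on t).
    by rewrite omega_central // subrr.
  by rewrite mulrN mulNr omega_central // subrr.
rewrite /volume_ratio volume_gen.
have [h0|h0] := volume_sign (h_rel 0) on (h_odd on 0); [left|right] => x;
  by rewrite (volE x 0) h0 ?mulNr divrr // omega_unit.
Qed.

(* [Z] solves the adjoint equation [Z' = - Z C]. *)
Lemma adjoint_solution_exists (C : R -> Cl) : curve_continuous C ->
  exists Z : R -> Cl, Z 0 = 1 /\ forall f : R -> Cl,
    (forall x, has_derivative f x (C x * f x)) -> forall x, Z x * f x = f 0.
Proof.
move=> Cc; have [|||Z [Z0 ZD]] := @clifford_linear_ode _ _ _ _ (fun x U => - (U * C x)) 1.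
- by move=> x U V; rewrite mulrDl opprD.
- by move=> x k U; rewrite -scalerAl scalerN.
- move=> U; rewrite (_ : (fun x => _) = fun x => (- U) * C x).
    by apply: curve_continuousM => //; apply: curve_continuous_cst.
  by apply/funext => x; rewrite mulNr.
exists Z; split=> // f fD x; rewrite -[RHS]mul1r -Z0.
apply: (@has_derivative0_cst _ _ _ _ (fun t => Z t * f t)) => t.
have := has_derivativeM (ZD t) (fD t).
by rewrite mulNr -mulrA addNr.
Qed.

Lemma solution_exists (C : R -> Cl) : curve_continuous C ->
  exists S, is_invertible_solution C S.
Proof.
move=> Cc; have [|||S [S0 SD]] := @clifford_linear_ode _ _ _ _ (fun x U => C x * U) 1.
- by move=> x U V; rewrite mulrDr.
- by move=> x k U; rewrite -scalerAr.
- by move=> U; apply: curve_continuousM => //; apply: curve_continuous_cst.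
(* As [S 0 = 1], the constant product [Z x * S x] is 1. *)
have [Z [_ ZP]] := adjoint_solution_exists Cc.
exists S; split=> // x; apply: (@left_inverse_unit _ _ _ _ (Z x)).
by rewrite ZP.
Qed.

(** Since $(h^a)' = [C, h^a]$, the curve $h^a S$ solves the same equation as $S$. The adjoint
    solution makes both products $Z S$ and $Z h^a S$ constant, and eliminating $Z$ gives the
    formula. *)
Lemma solution_conj (C S : R -> Cl) a x : curve_continuous C -> is_connection h C ->
  is_invertible_solution C S ->
  h a x * S x = S x * (S 0)^-1 * h a 0 * S 0.
Proof.
move=> Cc [_ CP] [Su SD]; have [Z [_ ZP]] := adjoint_solution_exists Cc.
have ZS := ZP S SD x.
have := ZP (fun t => h a t * S t) _ x; rewrite /= => ZhS.
rewrite -[RHS]mulrA -ZhS; last first.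
  move=> t; have [dh hD /eqP] := CP a t; rewrite subr_eq0 => /eqP dhE.
  move: (has_derivativeM hD (SD t)); rewrite dhE /bracket; congr has_derivative.
  by rewrite mulrBl !mulrA subrK.
have -> : Z x = S 0 / S x by rewrite -ZS mulrK.
by rewrite -!mulrA mulKr // mulVKr.
Qed.

Lemma pauli_at x : exists2 T, T \is a GRing.unit & forall a,
  (if odd n then volume_ratio h x else 1) * h a x * T = T * gen F a.
Proof.
rewrite /volume_ratio volume_gen.
case: (boolP (odd n)) => on; first by apply: pauli_odd => //; apply: h_odd.
have [T Tu TP] := pauli_even on (h_rel x).
by exists T => // a; rewrite mul1r.
Qed.

Lemma solution_transforms (C S : R -> Cl) : curve_continuous C -> is_connection h C ->
  is_invertible_solution C S ->
  exists2 k : Cl, k \is a GRing.unit & transforms_to_gen h (fun x => S x * k).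
Proof.
move=> Cc CP SP; have [Su _] := SP; have [T Tu TP] := pauli_at 0.
have S0Vu : (S 0)^-1 \is a GRing.unit by rewrite unitrV; exact: Su.
(* [T] is the Pauli element at 0, and [k] is chosen so that [S x * k] equals [T] at [x = 0]. *)
have [k ku kE] : exists2 k, k \is a GRing.unit & k = (S 0)^-1 * T.
  by exists ((S 0)^-1 * T); [rewrite (unitrMr T S0Vu); exact: Tu|].
have SkT : S 0 * k = T by rewrite kE (mulVKr (Su 0)).
have Sku x : S x * k \is a GRing.unit by rewrite (unitrMr k (Su x)); exact: ku.
have hSk a x : h a x * (S x * k) = S x * (S 0)^-1 * (h a 0 * T).
  by rewrite mulrA (solution_conj a x Cc CP SP) -SkT !mulrA.
have kSx x : S x * (S 0)^-1 * T = S x * k by rewrite kE mulrA.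
have conjE a x : (S x * k)^-1 * h a x * (S x * k) =
    (S x * k)^-1 * (S x * (S 0)^-1 * (h a 0 * T)).
  by rewrite -mulrA hSk.
exists k => //; split=> // on a x; have := TP a.
  rewrite (negPf on) mul1r conjE => ->.
  by rewrite (mulrA _ T) kSx (mulKr (Sku x)).
(* The ratio is one and the same sign at 0, where Pauli's theorem was applied, and at [x]. *)
rewrite on; have [r|r] := volume_ratio_cst CP on; rewrite !r ?mulN1r ?mul1r => TPa.
  by rewrite conjE TPa (mulrA _ T) kSx (mulKr (Sku x)).
rewrite !mulNr conjE -mulrN -mulrN -mulNr TPa.
by rewrite (mulrA _ T) kSx (mulKr (Sku x)).
Qed.

End Transport.

Theorem theorem5 (R : realType) (K : scalar_kind) (p q : nat)
    (n_ge2 : (2 <= p + q)%N)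
    (h : 'I_(p + q) -> R -> clifford (scalars R K) p q)
    (h_smooth : forall a, smooth (h a))
    (h_rel : forall a b x,
       h a x * h b x + h b x * h a x = (2 * cl_eta (scalars R K) a b) *: 1)
    (h_odd : odd (p + q) -> forall x, Tr (volume (h^~ x)) = 0) :
  [/\ exists T, transforms_to_gen h T,
      odd (p + q) -> (forall x, volume_ratio h x = 1) \/
                     (forall x, volume_ratio h x = -1) &
      exists C1 : R -> clifford (scalars R K) p q,
        [/\ is_connection h C1,
            forall C, is_connection h C -> C =1 C1,
            exists S, is_invertible_solution C1 S &
            forall S, is_invertible_solution C1 S ->
              exists2 k : clifford (scalars R K) p q,
                k \is a GRing.unit & transforms_to_gen h (fun x => S x * k)]].
Proof.
have h_rel' x : clifford_family (h^~ x) by move=> a b; apply: h_rel.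
have [C CP Cc] := connection_exists h_rel' h_smooth.
have [S SP] := solution_exists Cc.
split.
- have [k _ kT] := solution_transforms h_rel' h_odd Cc CP SP.
  by exists (fun x => S x * k).
- exact: volume_ratio_cst h_rel' h_odd _ CP.
exists C; split=> //; last 1 first.
- by move=> S' S'P; apply: solution_transforms.
- by move=> C' C'P; apply: connection_unique h_rel' h_odd _ _ C'P CP.
- by exists S.
Qed.
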